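(* Let $n\ge2$, let $\Omega_0\subset\mathbb R^n$ be a bounded convex domain, $x_0\in\Omega_0$, $\Omega=\Omega_0\setminus\{x_0\}$, and let $u$ be the $\infty$-harmonic potential of $\Omega$ (i.e. $u=0$ on $\partial\Omega_0$, $u(x_0)=1$). The following are equivalent: (i) $\Omega_0=B(x_0,r)$ for some $r>0$; (ii) $u\in C^2(\Omega)$; (iii) $u$ is concave on $\Omega_0$.
   Context: The $\infty$-harmonic potential of $\Omega=\Omega_0\setminus\{x_0\}$ is the unique $u\in C^0(\overline{\Omega_0})$ which is a viscosity solution (Crandall–Ishii–Lions sense) of $\Delta_\infty u:=\langle D^2u\,Du,Du\rangle=0$ in $\Omega$ with $u=0$ on $\partial\Omega_0$ and $u(x_0)=1$. *)

(* Defs.v *)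
From HB Require Import structures.
From mathcomp Require Import all_boot all_order all_algebra.
From mathcomp Require Import all_classical all_reals all_analysis.
Set Implicit Arguments. Unset Strict Implicit. Unset Printing Implicit Defensive.
Import Order.TTheory GRing.Theory Num.Theory.
Import numFieldNormedType.Exports.
Local Open Scope classical_set_scope.
Local Open Scope ring_scope.

Section Defs.
Variables (R : realType) (n : nat).
Local Notation V := 'rV[R]_n.

Definition evec (i : 'I_n) : V := \row_(j < n) (i == j)%:R.

Definition partial (i : 'I_n) (f : V -> R) : V -> R :=
  fun x => 'D_(evec i) f x.

Definition enorm (x : V) : R := Num.sqrt (\sum_(i < n) x ord0 i ^+ 2).
Definition eball (c : V) (r : R) : set V := [set y | enorm (y - c) < r].

Definition C2_on (U : set V) (f : V -> R) : Prop :=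
  {within U, continuous f} /\
  (forall i, (forall x, U x -> derivable f x (evec i)) /\
             {within U, continuous (partial i f)}) /\
  (forall i j, (forall x, U x -> derivable (partial i f) x (evec j)) /\
               {within U, continuous (partial j (partial i f))}).

Definition inf_laplacian (f : V -> R) (x : V) : R :=
  \sum_(i < n) \sum_(j < n)
     partial j (partial i f) x * partial i f x * partial j f x.

Definition visc_subsol (U : set V) (u : V -> R) : Prop :=
  forall x phi, U x ->
    (exists W : set V, [/\ open W, W x & C2_on W phi]) ->
    (\forall y \near x, u y - phi y <= u x - phi x) ->
    0 <= inf_laplacian phi x.

Definition visc_supersol (U : set V) (u : V -> R) : Prop :=
  forall x phi, U x ->
    (exists W : set V, [/\ open W, W x & C2_on W phi]) ->
    (\forall y \near x, u x - phi x <= u y - phi y) ->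
    inf_laplacian phi x <= 0.

Definition visc_sol (U : set V) (u : V -> R) : Prop :=
  {within U, continuous u} /\ visc_subsol U u /\ visc_supersol U u.

Definition convex_set (A : set V) : Prop :=
  forall x y (t : R), A x -> A y -> 0 <= t <= 1 -> A ((1 - t) *: x + t *: y).

Definition concave_on (A : set V) (u : V -> R) : Prop :=
  forall x y (t : R), A x -> A y -> 0 <= t <= 1 ->
    (1 - t) * u x + t * u y <= u ((1 - t) *: x + t *: y).

Definition bounded_convex_domain (O : set V) : Prop :=
  [/\ open O, connected O, bounded_set O & convex_set O].

Definition inf_harmonic_potential (O : set V) (x0 : V) (u : V -> R) : Prop :=
  [/\ {within closure O, continuous u},
      visc_sol (O `\ x0) u,
      (forall x, (closure O `\` O) x -> u x = 0) &
      u x0 = 1].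

End Defs.

(* Main.v *)
Require Import Defs.
From HB Require Import structures.
From mathcomp Require Import all_boot all_order all_algebra.
From mathcomp Require Import all_classical all_reals all_analysis.
From mathcomp Require Import ring lra.
Import Order.TTheory GRing.Theory Num.Theory.
Import numFieldNormedType.Exports.
Local Open Scope classical_set_scope.
Local Open Scope ring_scope.

Set Implicit Arguments.
Unset Strict Implicit.
Unset Printing Implicit Defensive.

(* Comparison with cones gives, with [d] the distance from [x0] to the boundary and [k = 1/d]:
   [u >= 1 - k|x - x0|], [u] is [k]-Lipschitz, and [u = 1 - k|x - x0|] on the segment to a
   nearest boundary point.  For [q x = (1 - u x)/|x - x0|], the cone with vertex [x] gives
   [q y >= q x (1 - 2 (1 - cos w))] when [y] is at most half as far from [x0] as [x] and [w] is
   the angle at [x0]; splitting an angle into many small ones makes the loss negligible, so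
   [q -> k] uniformly at [x0].

   If [u] is concave, [q] is nondecreasing along rays, so [q >= k] everywhere, and
   [u >= 0] confines the domain to the ball of radius [d].

   If [u] is C^2, then [|Du|^2] is constant along the gradient flow.  Flow lines are never
   constructed: invariance is used through the critical points of auxiliary functions over
   regions [t <= u <= t'] (a critical point of [F(|Du|^2) + e u] satisfies [e |Du|^2 = 0]).  A
   barrier argument shows that [Du] does not vanish.  Where [|Du|] is minimal the flow is
   straight, so [p.(x - x0) - u] (with [p = Du]) is constant and equal to its value [-1] at
   the pole; this forces [q <= min |Du|], hence [min |Du| = k].  Since [|Du| <= k], every point
   is minimal, [p.(x - x0) - u = -1] everywhere, [q] is constant along rays, and
   [u = 1 - k|x - x0|] in the ball of radius [d].  A point of the domain on the sphere of radius
   [d] would be an interior minimum of [u], contradicting [Du <> 0]. *)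

(** * Euclidean inner product and norm on row vectors *)

Section Euclidean.
Context {R : realType} {n : nat}.
Implicit Types x y z : 'rV[R]_n.

Definition dot x y : R := \sum_(i < n) x ord0 i * y ord0 i.

Lemma dotC x y : dot x y = dot y x.
Proof. by apply: eq_bigr => i _; rewrite mulrC. Qed.

Lemma dotDl x y z : dot (x + y) z = dot x z + dot y z.
Proof. by rewrite /dot -big_split; apply: eq_bigr => i _; rewrite mxE mulrDl. Qed.

Lemma dotZl (a : R) x y : dot (a *: x) y = a * dot x y.
Proof. by rewrite /dot mulr_sumr; apply: eq_bigr => i _; rewrite mxE mulrA. Qed.

Lemma dot0l y : dot 0 y = 0.
Proof. by rewrite -(scale0r 0) dotZl mul0r. Qed.

Lemma dotNl x y : dot (- x) y = - dot x y.
Proof. by rewrite -scaleN1r dotZl mulN1r. Qed.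

Lemma dotBl x y z : dot (x - y) z = dot x z - dot y z.
Proof. by rewrite dotDl dotNl. Qed.

Lemma dotDr x y z : dot x (y + z) = dot x y + dot x z.
Proof. by rewrite dotC dotDl !(dotC x). Qed.

Lemma dotZr (a : R) x y : dot x (a *: y) = a * dot x y.
Proof. by rewrite dotC dotZl (dotC x). Qed.

Lemma dot0r x : dot x 0 = 0.
Proof. by rewrite dotC dot0l. Qed.

Lemma dotNr x y : dot x (- y) = - dot x y.
Proof. by rewrite dotC dotNl (dotC x). Qed.

Lemma dotBr x y z : dot x (y - z) = dot x y - dot x z.
Proof. by rewrite dotDr dotNr. Qed.

Definition dotE := (dotBl, dotBr, dotDl, dotDr, dotNl, dotNr, dotZl, dotZr).

Lemma dot_ge0 x : 0 <= dot x x.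
Proof. by apply: sumr_ge0 => i _; rewrite -expr2 sqr_ge0. Qed.

Lemma enormE x : enorm x = Num.sqrt (dot x x).
Proof. by rewrite /enorm; congr Num.sqrt; apply: eq_bigr => i _; rewrite expr2. Qed.

Lemma sqr_enorm x : enorm x ^+ 2 = dot x x.
Proof. by rewrite enormE sqr_sqrtr ?dot_ge0. Qed.

Lemma enorm_ge0 x : 0 <= enorm x.
Proof. exact: sqrtr_ge0. Qed.

Lemma enorm_eq0 x : (enorm x == 0) = (x == 0).
Proof.
apply/eqP/eqP => [x0|->]; last first.
  by rewrite enormE dot0l sqrtr0.
have : dot x x == 0 by rewrite -sqr_enorm x0 expr0n.
rewrite psumr_eq0 => [/allP /= h|i _]; last by rewrite -expr2 sqr_ge0.
apply/rowP => i; have := h i; rewrite mem_index_enum => /(_ isT).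
by rewrite mulf_eq0 orbb mxE => /eqP.
Qed.

Lemma enorm0 : enorm (0 : 'rV[R]_n) = 0.
Proof. by apply/eqP; rewrite enorm_eq0. Qed.

Lemma enorm_gt0 x : (0 < enorm x) = (x != 0).
Proof. by rewrite lt_def enorm_ge0 andbT enorm_eq0. Qed.

Lemma enorm_sub_gt0 x y : x <> y -> 0 < enorm (x - y).
Proof. by move=> xy; rewrite enorm_gt0 subr_eq0; apply/eqP. Qed.

Lemma enormZ (a : R) x : enorm (a *: x) = `|a| * enorm x.
Proof.
rewrite !enormE dotZl dotZr mulrA -expr2 sqrtrM ?sqr_ge0//.
by rewrite sqrtr_sqr.
Qed.

Lemma enormN x : enorm (- x) = enorm x.
Proof. by rewrite -scaleN1r enormZ normrN normr1 mul1r. Qed.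

Lemma enormB x y : enorm (x - y) = enorm (y - x).
Proof. by rewrite -enormN opprB. Qed.

Lemma dot_le_enorm x y : dot x y <= enorm x * enorm y.
Proof.
have [->|x0] := eqVneq x 0.
  by rewrite enorm0 mul0r dot0l.
have [->|y0] := eqVneq y 0.
  by rewrite enorm0 mulr0 dot0r.
have := dot_ge0 (enorm y *: x - enorm x *: y).
rewrite !dotE -!sqr_enorm (dotC y x).
move: x0 y0; rewrite -!enorm_gt0 => x0 y0.
have xy0 : 0 < 2 * (enorm x * enorm y) by rewrite !mulr_gt0.
move=> h; rewrite -subr_ge0 -(pmulr_rge0 _ xy0); apply: le_trans h _.
by rewrite le_eqVlt; apply/orP; left; apply/eqP; ring.
Qed.

Lemma ler_enormD x y : enorm (x + y) <= enorm x + enorm y.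
Proof.
rewrite -(@ler_pXn2r _ 2%N) ?nnegrE ?addr_ge0 ?enorm_ge0//.
rewrite sqr_enorm !dotE sqrrD !sqr_enorm (dotC y x).
have := dot_le_enorm x y; lra.
Qed.

Lemma ler_enorm_trans x y z : enorm (x - z) <= enorm (x - y) + enorm (y - z).
Proof. by have := ler_enormD (x - y) (y - z); rewrite addrA subrK. Qed.

Lemma coord_le_enorm x i : `|x ord0 i| <= enorm x.
Proof.
rewrite -sqrtr_sqr; apply: ler_wsqrtr.
by rewrite (bigD1 i)//= lerDl sumr_ge0// => j _; rewrite sqr_ge0.
Qed.

Lemma mxnorm_le_enorm x : `|x| <= enorm x.
Proof.
rewrite [leLHS]/Num.Def.normr /= mx_normrE; apply/bigmax_leP; split; first exact: enorm_ge0.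
by move=> [i j] _ /=; rewrite ord1 coord_le_enorm.
Qed.

(** The factor [n.+1] is cruder than the square root of [n], but it is positive for every [n], so
    one can divide by it. *)
Lemma enorm_le_mxnorm x : enorm x <= n.+1%:R * `|x|.
Proof.
rewrite -(@ler_pXn2r _ 2%N) ?nnegrE ?mulr_ge0 ?enorm_ge0//.
rewrite sqr_enorm exprMn.
apply: (@le_trans _ _ (\sum_(i < n) `|x| ^+ 2)).
  apply: ler_sum => i _; rewrite -expr2 -real_normK ?num_real//.
  rewrite ler_pXn2r ?nnegrE//.
  rewrite [leRHS]/Num.Def.normr /= mx_normrE.
  by apply/bigmax_geP; right; exists (ord0, i).
rewrite sumr_const card_ord -[leLHS]mulr_natl ler_wpM2r ?sqr_ge0//.
rewrite -natrX ler_nat; apply: (@leq_trans n.+1) => //.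
by rewrite -{1}(expn1 n.+1) leq_pexp2l.
Qed.

Lemma ler_dist_enorm x y : `|enorm x - enorm y| <= enorm (x - y).
Proof.
have := ler_enormD (x - y) y; have := ler_enormD (y - x) x.
rewrite !subrK (enormB y x) => h1 h2.
by rewrite ler_norml; apply/andP; split; lra.
Qed.

Lemma enorm_continuous : continuous (@enorm R n).
Proof.
move=> x; apply/(@cvgrPdist_lt _ R^o _ (nbhs x)) => e e0; near=> y.
apply: le_lt_trans (ler_dist_enorm _ _) _.
apply: le_lt_trans (enorm_le_mxnorm _) _.
rewrite -ltr_pdivlMl ?ltr0Sn//.
by near: y; apply: cvgr_dist_lt => //; rewrite mulr_gt0 ?invr_gt0 ?ltr0Sn.
Unshelve. all: by end_near. Qed.

Lemma enormB_continuous z : continuous (fun x => enorm (x - z)).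
Proof.
move=> x; apply: (@continuous_comp _ _ _ (fun x => x - z) (@enorm R n)).
  by apply: (@continuousB R 'rV[R]_n 'rV[R]_n id (cst z)) => //; exact: cst_continuous.
exact: enorm_continuous.
Qed.

Lemma open_eball z (r : R) : open (eball z r).
Proof.
rewrite (_ : eball z r = (fun x => enorm (x - z)) @^-1` [set t | t < r])//.
by apply: open_comp; [move=> ? _; exact: enormB_continuous|exact: open_lt].
Qed.

Lemma nbhs_eball z (r : R) : 0 < r -> nbhs z (eball z r).
Proof.
move=> r0; apply: open_nbhs_nbhs; split; first exact: open_eball.
by rewrite /eball/= subrr enorm0.
Qed.

(** The ambient topology is that of the max norm; equivalence of the two norms lets neighbourhoods
    be tested on Euclidean balls. *)
Lemma nbhs_eballP z (A : set 'rV[R]_n) :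
  nbhs z A <-> exists2 r : R, 0 < r & eball z r `<=` A.
Proof.
split=> [/nbhs_normP[r /= r0 rA]|[r r0 rA]].
  exists r => // y zy; apply: rA => /=.
  by rewrite distrC; apply: le_lt_trans (mxnorm_le_enorm _) _.
by apply: filterS rA _; exact: nbhs_eball.
Qed.

Lemma enorm_bounded (A : set 'rV[R]_n) z (M : R) :
  (forall x, A x -> enorm (x - z) <= M) -> bounded_set A.
Proof.
move=> AM; exists (M + enorm z); split; first exact: num_real.
move=> N /ltW MN x /AM xM; apply: le_trans (mxnorm_le_enorm _) (le_trans _ MN).
by have := ler_enormD (x - z) z; rewrite subrK; lra.
Qed.

Lemma bounded_enorm (A : set 'rV[R]_n) z : bounded_set A ->
  exists M : R, forall x, A x -> enorm (x - z) <= M.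
Proof.
move=> [M [_ /(_ (M + 1))]]; rewrite ltrDl ltr01 => /(_ isT) AM.
exists (n.+1%:R * (M + 1 + `|z|)) => x /AM /= xM.
apply: le_trans (enorm_le_mxnorm _) _.
rewrite ler_wpM2l// (le_trans (ler_normB _ _))// lerD2r//.
Qed.

Lemma closure_enorm_le (A : set 'rV[R]_n) z (M : R) :
  (forall x, A x -> enorm (x - z) <= M) -> forall x, closure A x -> enorm (x - z) <= M.
Proof.
have cM : closed [set x : 'rV[R]_n | enorm (x - z) <= M].
  rewrite (_ : [set x | _] = (fun x => enorm (x - z)) @^-1` [set t | t <= M])//.
  by apply: closed_comp; [move=> ? _; exact: enormB_continuous|exact: closed_le].
by move=> AM x cx; apply: cM; move: x cx; apply: closure_subset.
Qed.

End Euclidean.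

(** * Extreme values on compact sets *)

Section Compact.
Context {R : realType} {n : nat}.
Implicit Types (A : set 'rV[R]_n) (f : 'rV[R]_n -> R).

Lemma compact_max A f : compact A -> A !=set0 ->
  (forall x, A x -> {for x, continuous f}) ->
  exists c, A c /\ forall x, A x -> f x <= f c.
Proof.
move=> cA A0 cf; have [|c] := @compact_EVT_max _ R f A A0 cA.
  by apply: continuous_in_subspaceT => x /set_mem; exact: cf.
by move=> /set_mem Ac h; exists c; split => // x Ax; apply: h; exact: mem_set.
Qed.

Lemma compact_min A f : compact A -> A !=set0 ->
  (forall x, A x -> {for x, continuous f}) ->
  exists c, A c /\ forall x, A x -> f c <= f x.
Proof.
move=> cA A0 cf; have [|c] := @compact_EVT_min _ R f A A0 cA.
  by apply: continuous_in_subspaceT => x /set_mem; exact: cf.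
by move=> /set_mem Ac h; exists c; split => // x Ax; apply: h; exact: mem_set.
Qed.

Lemma compact_norm_bound A f : compact A ->
  (forall x, A x -> {for x, continuous f}) ->
  exists2 M : R, 0 < M & forall x, A x -> `|f x| <= M.
Proof.
move=> cA cf; have [A0|/set0P/negP/negPn/eqP A0] := pselect (A !=set0); last first.
  by exists 1 => // x; rewrite A0.
have [|c [_ h]] := @compact_max A (fun x => `|f x|) cA A0.
  move=> x Ax; apply: (@continuous_comp _ _ _ f Num.norm); first exact: cf.
  exact: norm_continuous.
by exists (`|f c| + 1) => [|x /h fx]; [rewrite ltr_wpDl|rewrite (le_trans fx)// lerDl].
Qed.

(** The potential is given as continuous relative to the closure of its domain; this relative form
    makes its level regions compact. *)
Lemma within_closed_compact A f (B : set R) : compact A -> closed B ->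
  {within A, continuous f} -> compact (A `&` f @^-1` B).
Proof.
move=> cA cB /continuous_closedP/(_ _ cB)/closed_subspaceP[V cV VB].
rewrite setIC -VB setIC; apply: compact_closedI => //.
Qed.

End Compact.

(** * Directional derivatives, extrema and mean values along lines *)

Section Directional.
Context {R : realType} {n : nat}.
Implicit Types (x v w : 'rV[R]_n) (f g : 'rV[R]_n -> R).

Lemma line_quotient f x v (t : R) :
  (fun h : R => h^-1 *: (((fun s : R => f (x + s *: v)) \o shift t) (h *: (1 : R))
     - f (x + t *: v))) =
  (fun h : R => h^-1 *: ((f \o shift (x + t *: v)) (h *: v) - f (x + t *: v))).
Proof.
apply/funext => h /=; congr (_ *: (f _ - _)).
by rewrite [h *: 1]mulr1 scalerDl addrCA.
Qed.

(** Passes to a function of one real variable, where the chain rule and the mean value theorem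
    apply. *)
Lemma is_derive_line f x v (t d : R) :
  is_derive (x + t *: v) v f d <->
  is_derive (t : R) (1 : R) (fun s : R => f (x + s *: v)) d.
Proof.
by split=> -[h1 h2]; split; move: h1 h2; rewrite /derivable /derive line_quotient.
Qed.

Lemma is_derive_comp1 f x v (h : R -> R) (df dh : R) :
  is_derive x v f df -> is_derive (f x) (1 : R) h dh ->
  is_derive x v (fun y => h (f y)) (dh * df).
Proof.
have -> : x = x + 0 *: v by rewrite scale0r addr0.
move=> /is_derive_line hf hh; apply/is_derive_line.
exact: (@is_derive1_comp _ h (fun s : R => f (x + s *: v))).
Qed.

Lemma shift_line_continuous x v (t : R) :
  {for t, continuous (fun s : R => x + s *: v)}.
Proof.
apply: cvgD; first exact: cvg_cst.
by apply: cvgZr_tmp; exact: cvg_id.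
Qed.

(** If [d > 0], a small positive [h] gives a point of larger value; if [d < 0], a small negative [h]
    does. *)
Lemma local_max_derive f x v (d : R) :
  (\forall y \near x, f y <= f x) -> is_derive x v f d -> d = 0.
Proof.
move=> xmax [df dE].
have hcvg : (fun h : R => h^-1 *: ((f \o shift x) (h *: v) - f x)) h @[h --> 0^'] --> d.
  by rewrite -dE.
have hx : \forall h \near (0 : R), f (h *: v + x) <= f x.
  have /(_ _) := @shift_line_continuous x v 0; rewrite /continuous_at/=.
  rewrite scale0r addr0 => /(_ _ xmax) H.
  have {}H : \forall s \near (0 : R), f (x + s *: v) <= f x by exact: H.
  by apply: filterS H => h; rewrite addrC.
apply/eqP; rewrite eq_le; apply/andP; split; rewrite leNgt; apply/negP => d0.
  have : \forall h \near 0^', 0 < h^-1 *: ((f \o shift x) (h *: v) - f x).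
    exact: cvgr_gt hcvg _ d0.
  move=> /nbhs_ballP[e /= e0 he]; have /nbhs_ballP[e' /= e'0 he'] := hx.
  pose h := Num.min e e' / 2.
  have h0 : 0 < h by rewrite divr_gt0// lt_min e0.
  have hmin : h < Num.min e e' by rewrite ltr_pdivrMr// ltr_pMr ?lt_min ?e0// ltr1n.
  have := he h; rewrite /ball/= sub0r normrN gtr0_norm// => /(_ _ _).
  have := he' h; rewrite /ball/= sub0r normrN gtr0_norm// => /(_ _).
  move: hmin; rewrite lt_min => /andP[hE hE'] /(_ hE') fle /(_ hE (lt0r_neq0 h0)).
  by rewrite [X in 0 < X]/GRing.scale/= pmulr_rgt0 ?invr_gt0// subr_gt0 ltNge fle.
have : \forall h \near 0^', h^-1 *: ((f \o shift x) (h *: v) - f x) < 0.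
  exact: cvgr_lt hcvg _ d0.
move=> /nbhs_ballP[e /= e0 he]; have /nbhs_ballP[e' /= e'0 he'] := hx.
pose h := - (Num.min e e' / 2).
have h0 : h < 0 by rewrite oppr_lt0 divr_gt0// lt_min e0.
have hmin : - h < Num.min e e'.
  by rewrite opprK ltr_pdivrMr// ltr_pMr ?lt_min ?e0// ltr1n.
have := he h; rewrite /ball/= sub0r normrN ltr0_norm// => /(_ _ _).
have := he' h; rewrite /ball/= sub0r normrN ltr0_norm// => /(_ _).
move: hmin; rewrite lt_min => /andP[hE hE'] /(_ hE') fle /(_ hE (ltr0_neq0 h0)).
by rewrite [X in X < 0]/GRing.scale/= nmulr_rlt0 ?invr_lt0// subr_gt0 ltNge fle.
Qed.

Lemma local_min_derive f x v (d : R) :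
  (\forall y \near x, f x <= f y) -> is_derive x v f d -> d = 0.
Proof.
move=> xmin hf; apply/eqP; rewrite -oppr_eq0; apply/eqP.
apply: (@local_max_derive (fun y => - f y) x v).
by apply: filterS xmin => y; rewrite lerN2.
Qed.

Lemma MVT_line f x v (h : R) : 0 < h ->
  (forall s : R, 0 <= s <= h -> derivable f (x + s *: v) v) ->
  exists2 s : R, 0 < s < h & f (x + h *: v) - f x = h * 'D_v f (x + s *: v).
Proof.
move=> h0 df; pose g (s : R) := f (x + s *: v).
have dg (s : R) : 0 <= s <= h -> is_derive s (1 : R) g ('D_v f (x + s *: v)).
  by move=> /df/derivableP/is_derive_line.
have [||s] := @MVT R g (fun s => 'D_v f (x + s *: v)) 0 h h0.
- by move=> s; rewrite in_itv/= => /andP[s0 sh]; apply: dg; rewrite !ltW.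
- apply: derivable_within_continuous => s; rewrite in_itv/= => /dg hs.
  exact: ex_derive.
rewrite in_itv/= => sh; rewrite /g scale0r addr0 subr0 mulrC => E.
by exists s.
Qed.

Lemma MVT_signed f x v (c : R) :
  (forall s : R, `|s| <= `|c| -> derivable f (x + s *: v) v) ->
  exists2 s : R, `|s| <= `|c| & f (x + c *: v) - f x = c * 'D_v f (x + s *: v).
Proof.
move=> df; have [c0|c0|->] := ltgtP c 0; last first.
- by exists 0; rewrite ?normr0// scale0r addr0 subrr mul0r.
- have [|s /andP[s0 sc] E] := @MVT_line f x v c c0.
    by move=> s /andP[s0 sc]; apply: df; rewrite ger0_norm// gtr0_norm.
  by exists s => //; rewrite gtr0_norm// gtr0_norm// ltW.
- have c0' : 0 < - c by rewrite oppr_gt0.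
  have [|s /andP[s0 sc] E] := @MVT_line f (x + c *: v) v (- c) c0'.
    move=> s /andP[s0 sc]; rewrite -addrA -scalerDl; apply: df.
    by rewrite (ltr0_norm c0) ler0_norm; lra.
  exists (c + s); first by rewrite (ltr0_norm c0) ler0_norm; lra.
  move: E; rewrite -!addrA -!scalerDl subrr scale0r addr0 => E.
  by apply/eqP; rewrite -eqr_opp opprB E mulNr.
Qed.

(** The mean value theorem is applied to the first difference [g] in direction [v], then to the
    [v]-derivative in direction [w]. *)
Lemma mixed_difference f x v w (h : R) : 0 < h ->
  (forall s t : R, 0 <= s <= h -> 0 <= t <= h ->
    derivable f (x + s *: v + t *: w) v /\
    derivable (fun y => 'D_v f y) (x + s *: v + t *: w) w) ->
  exists s t : R, [/\ 0 < s < h, 0 < t < h &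
    f (x + h *: v + h *: w) - f (x + h *: v) - f (x + h *: w) + f x =
    h * (h * 'D_w (fun y => 'D_v f y) (x + s *: v + t *: w))].
Proof.
move=> h0 df; have hh : 0 <= h <= h by rewrite ltW/=.
have h00 : 0 <= (0 : R) <= h by rewrite lexx ltW.
pose g y := f (y + h *: w) - f y.
have dg (s : R) : 0 <= s <= h ->
    is_derive (x + s *: v) v g ('D_v f (x + s *: v + h *: w) - 'D_v f (x + s *: v)).
  move=> hs; apply: (@is_deriveB _ _ _ (fun y => f (y + h *: w)) f).
    have [/derivableP H _] := df s h hs hh; apply/is_derive_line.
    have -> : (fun r : R => f (x + r *: v + h *: w)) =
              (fun r : R => f (x + h *: w + r *: v)).
      by apply/funext => r; rewrite addrAC.
    by move: H; rewrite (addrAC x) => /is_derive_line.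
  by have [+ _] := df s 0 hs h00; rewrite scale0r addr0 => /derivableP.
have [|s sh E] := @MVT_line g x v h h0.
  by move=> s /dg []. 
have sh' : 0 <= s <= h by case/andP: sh => ? ?; rewrite !ltW.
have [|t th E'] := @MVT_line (fun y => 'D_v f y) (x + s *: v) w h h0.
  by move=> t /(df s t sh') [].
exists s, t; split=> //; rewrite -E' -(@derive_val _ _ _ _ _ _ _ (dg s sh')) -E /g.
by rewrite opprB addrA addrAC.
Qed.

End Directional.

(** * First-order expansion and symmetry of second derivatives *)

Section C1.
Context {R : realType} {n : nat}.
Implicit Types (x v w : 'rV[R]_n) (f g : 'rV[R]_n -> R) (U : set 'rV[R]_n).

Lemma evecE i j : @evec R n i ord0 j = (i == j)%:R.
Proof. by rewrite mxE. Qed.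

Lemma enorm_evec i : enorm (@evec R n i) = 1.
Proof.
rewrite enormE /dot (bigD1 i)//= big1 ?addr0 => [|j ji].
  by rewrite evecE eqxx mulr1 sqrtr1.
by rewrite evecE eq_sym (negbTE ji) mul0r.
Qed.

Lemma dot_evec x i : dot x (evec R i) = x ord0 i.
Proof.
rewrite /dot (bigD1 i)//= big1 ?addr0 => [|j ji]; rewrite evecE.
  by rewrite eqxx mulr1.
by rewrite eq_sym (negbTE ji) mulr0.
Qed.

Lemma open_within_continuous U f x : open U -> {within U, continuous f} -> U x ->
  {for x, continuous f}.
Proof.
by move=> oU; rewrite continuous_open_subspace// => h Ux; apply: h; exact: mem_set.
Qed.

(** The coordinates of [w] are switched on one at a time; the mean value theorem handles each step
    and the increments telescope. *)
Lemma C1_increment U f x (e : R) : open U -> U x ->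
  (forall i y, U y -> derivable f y (evec R i)) ->
  (forall i, {for x, continuous (partial i f)}) -> 0 < e ->
  exists2 r : R, 0 < r & forall w, enorm w < r ->
    `|f (x + w) - f x - \sum_(i < n) w ord0 i * partial i f x| <=
    e * \sum_(i < n) `|w ord0 i|.
Proof.
move=> oU Ux df cf e0.
have nearx : nbhs x
    (U `&` [set y | forall i : 'I_n, `|partial i f x - partial i f y| <= e]).
  apply: filterI; first exact: open_nbhs_nbhs.
  apply: (@filter_forall _ _
    (fun (i : 'I_n) (y : 'rV[R]_n) => `|partial i f x - partial i f y| <= e) (nbhs x)).
  by move=> j; have /cvgrPdist_le := cf j; apply.
have /nbhs_eballP[r r0 hr] := nearx.
exists r => // w wr.
pose trunc (m : nat) : 'rV[R]_n := \row_i (if (i < m)%N then w ord0 i else 0).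
have truncS (i : 'I_n) : trunc i.+1 = trunc i + w ord0 i *: evec R i.
  apply/rowP => j; rewrite !mxE ltnS leq_eqVlt eq_sym.
  have [<-|ij] := eqVneq i j; first by rewrite eqxx ltnn mulr1 add0r.
  by rewrite mulr0 addr0; move: ij; rewrite -val_eqE => /negbTE ->.
(* Every intermediate displacement is at most as long as [w], so the whole broken path stays in the
   ball. *)
have trunc_le (i : 'I_n) (s : R) : `|s| <= `|w ord0 i| ->
    enorm (trunc i + s *: evec R i) <= enorm w.
  move=> sw; rewrite -(@ler_pXn2r _ 2%N) ?nnegrE ?enorm_ge0// !sqr_enorm.
  apply: ler_sum => j _; rewrite -!expr2 !mxE.
  have [<-|ij] := eqVneq i j.
    rewrite ltnn add0r mulr1 -(real_normK (num_real s)) -(real_normK (num_real (w _ _))).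
    by rewrite ler_pXn2r ?nnegrE.
  by rewrite mulr0 addr0; case: ifP => // _; rewrite expr0n sqr_ge0.
have inU (i : 'I_n) (s : R) : `|s| <= `|w ord0 i| ->
   eball x r (x + trunc i + s *: evec R i).
  move=> sw; rewrite /eball/= -(addrA x) addrAC subrr add0r.
  by apply: le_lt_trans wr; exact: trunc_le.
have step (i : 'I_n) :
    `|f (x + trunc i.+1) - f (x + trunc i) - w ord0 i * partial i f x| <=
    e * `|w ord0 i|.
  have [|s sw] := @MVT_signed _ _ f (x + trunc i) (evec R i) (w ord0 i).
    by move=> s sw; apply: df; case: (hr _ (inU i s sw)).
  rewrite truncS addrA => ->; rewrite -mulrBr normrM mulrC.
  by rewrite ler_wpM2r// distrC; case: (hr _ (inU i s sw)) => _; exact.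
have -> : f (x + w) - f x = \sum_(i < n) (f (x + trunc i.+1) - f (x + trunc i)).
  rewrite -(big_mkord xpredT (fun i => f (x + trunc i.+1) - f (x + trunc i))).
  rewrite telescope_sumr//; congr (f _ - f _).
    by congr (x + _); apply/rowP => j; rewrite mxE ltn_ord.
  by rewrite -[LHS]addr0; congr (x + _); apply/rowP => j; rewrite !mxE.
rewrite -sumrB; apply: le_trans (ler_norm_sum _ _ _) _.
by rewrite mulr_sumr; apply: ler_sum.
Qed.

(** The second difference over a square of side [h] is symmetric in [i] and [j], and equals [h ^+ 2]
    times either mixed derivative at some nearby point. *)
Lemma partialC U f x i j : open U -> U x ->
  (forall i y, U y -> derivable f y (evec R i)) ->
  (forall i j y, U y -> derivable (partial i f) y (evec R j)) ->
  (forall i j, {for x, continuous (partial j (partial i f))}) ->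
  partial j (partial i f) x = partial i (partial j f) x.
Proof.
move=> oU Ux df ddf cf; apply/eqP/negPn/negP => neq.
pose D := `|partial j (partial i f) x - partial i (partial j f) x|; pose e := D / 2.
have e0 : 0 < e by rewrite divr_gt0// normr_gt0 subr_eq0.
have near_c k l : \forall y \near x,
    `|partial l (partial k f) x - partial l (partial k f) y| < e.
  by have /cvgrPdist_lt := cf k l; apply.
have /nbhs_eballP[r r0 hr] : nbhs x
  (U `&` ([set y | `|partial j (partial i f) x - partial j (partial i f) y| < e]
   `&` [set y | `|partial i (partial j f) x - partial i (partial j f) y| < e])).
  by apply: filterI; [exact: open_nbhs_nbhs|apply: filterI; exact: near_c].
(* Two displacements of length at most [r / 3] stay inside the ball of radius [r]. *)
pose h := r / 3.
have h0 : 0 < h by rewrite divr_gt0.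
have inr k l (s t : R) : 0 <= s <= h -> 0 <= t <= h ->
    eball x r (x + s *: evec R k + t *: evec R l).
  move=> /andP[s0 sh] /andP[t0 th]; rewrite /eball/= -(addrA x) addrAC subrr add0r.
  apply: le_lt_trans (ler_enormD _ _) _.
  rewrite !enormZ !enorm_evec !mulr1 (ger0_norm s0) (ger0_norm t0).
  by move: sh th r0; rewrite /h; clear; lra.
have key k l : exists s t : R, [/\ 0 < s < h, 0 < t < h & 
    f (x + h *: evec R k + h *: evec R l) - f (x + h *: evec R k) - f (x + h *: evec R l) + f x =
    h * (h * partial l (partial k f) (x + s *: evec R k + t *: evec R l))].
  apply: mixed_difference => // s t hs ht.
  by have [Uy _] := hr _ (inr k l s t hs ht); split; [exact: df|exact: ddf].
have [s [t [/andP[s0 sh] /andP[t0 th] E]]] := key i j.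
have [s' [t' [/andP[s'0 s'h] /andP[t'0 t'h] E']]] := key j i.
have hE : partial j (partial i f) (x + s *: evec R i + t *: evec R j) =
          partial i (partial j f) (x + s' *: evec R j + t' *: evec R i).
  apply: (mulfI (lt0r_neq0 h0)); apply: (mulfI (lt0r_neq0 h0)).
  apply: etrans (esym E) (etrans _ E').
  rewrite (addrAC x (h *: evec R i) (h *: evec R j)); congr (_ + _).
  exact: addrAC.
have [_ [h1 _]] := hr _ (inr i j s t ltac:(rewrite !ltW//) ltac:(rewrite !ltW//)).
have [_ [_ h2]] := hr _ (inr j i s' t' ltac:(rewrite !ltW//) ltac:(rewrite !ltW//)).
move: h1; rewrite /= hE => h1.
have : D < e + e.
  apply: le_lt_trans (ler_distD _ _ _) (ltrD h1 _).
  rewrite distrC; exact: h2.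
by rewrite /e -splitr ltxx.
Qed.

End C1.

(** * Derivation and continuity rules for functions written pointwise *)

Section PointwiseRules.
Context {R : realType} {n : nat}.
Implicit Types (x v z : 'rV[R]_n) (f g : 'rV[R]_n -> R).

Lemma is_derive_addf f g x v (df dg : R) :
  is_derive x v f df -> is_derive x v g dg ->
  is_derive x v (fun y => f y + g y) (df + dg).
Proof. by move=> hf hg; exact: is_deriveD. Qed.

Lemma is_derive_oppf f x v (df : R) :
  is_derive x v f df -> is_derive x v (fun y => - f y) (- df).
Proof. by move=> hf; exact: is_deriveN. Qed.

Lemma is_derive_subf f g x v (df dg : R) :
  is_derive x v f df -> is_derive x v g dg ->
  is_derive x v (fun y => f y - g y) (df - dg).
Proof. by move=> hf hg; exact: is_deriveB. Qed.

Lemma is_derive_mulf f g x v (df dg : R) :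
  is_derive x v f df -> is_derive x v g dg ->
  is_derive x v (fun y => f y * g y) (df * g x + f x * dg).
Proof.
move=> hf hg; apply: is_derive_eq (is_deriveM hf hg) _.
by rewrite addrC [g x *: df]mulrC.
Qed.

Lemma is_derive_cstf (c : R) x v : is_derive x v (fun=> c) 0.
Proof. exact: is_derive_cst. Qed.

Lemma is_derive_scalef (c : R) f x v (df : R) :
  is_derive x v f df -> is_derive x v (fun y => c * f y) (c * df).
Proof.
move=> hf; apply: is_derive_eq (is_derive_mulf (is_derive_cstf c x v) hf) _.
by rewrite mul0r add0r.
Qed.

Lemma is_derive_sumf (F : 'I_n -> 'rV[R]_n -> R) x v (dF : 'I_n -> R) :
  (forall i, is_derive x v (F i) (dF i)) ->
  is_derive x v (fun y => \sum_(i < n) F i y) (\sum_(i < n) dF i).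
Proof.
move=> h; have := is_derive_sum h.
by rewrite (_ : \sum_(i < n) F i = (fun y => \sum_(i < n) F i y))// fct_sumE.
Qed.

Lemma is_derive_sqrf f x v (df : R) :
  is_derive x v f df -> is_derive x v (fun y => f y ^+ 2) (2 * f x * df).
Proof.
move=> hf; apply: is_derive_eq (is_derive_mulf hf hf) _.
by ring.
Qed.

Lemma is_derive_coord z x v i :
  is_derive x v (fun y : 'rV[R]_n => (y - z) ord0 i) (v ord0 i).
Proof.
have -> : x = x + 0 *: v by rewrite scale0r addr0.
apply/is_derive_line.
rewrite (_ : (fun s : R => _) = (fun s : R => (x - z) ord0 i + s * v ord0 i)); last first.
  by apply/funext => s; rewrite !mxE addrAC.
apply: is_derive_eq.
by rewrite scaler0 !add0r mul1r [LHS]mulr1.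
Qed.

Lemma is_derive_sqr_enorm z x v :
  is_derive x v (fun y => dot (y - z) (y - z)) (2 * dot (x - z) v).
Proof.
apply: is_derive_eq.
  apply: is_derive_sumf => i.
  exact: is_derive_mulf (is_derive_coord z x v i) (is_derive_coord z x v i).
by rewrite mulr_sumr; apply: eq_bigr => i _; ring.
Qed.

Lemma is_derive_enorm z x v : x <> z ->
  is_derive x v (fun y => enorm (y - z)) (dot (x - z) v / enorm (x - z)).
Proof.
move=> xz; have r0 := enorm_sub_gt0 xz.
have -> : (fun y => enorm (y - z)) = (fun y => Num.sqrt (dot (y - z) (y - z))).
  by apply/funext => y; rewrite enormE.
apply: is_derive_eq.
  apply: is_derive_comp1; first exact: is_derive_sqr_enorm.
  by apply: is_derive1_sqrt; rewrite -sqr_enorm exprn_gt0.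
rewrite -enormE invfM mulrACA mulVf ?pnatr_eq0// mul1r mulrC//.
Qed.

Lemma is_derive_inv_enorm z x v : x <> z ->
  is_derive x v (fun y => (enorm (y - z))^-1)
    (- (dot (x - z) v / enorm (x - z) ^+ 3)).
Proof.
move=> xz; have r0 := lt0r_neq0 (enorm_sub_gt0 xz).
have [d1 d2] := is_derive_enorm v xz.
split; first exact: derivableV.
rewrite deriveV// d2; move: (dot _ _) (enorm _) r0 => a r r0.
transitivity (- r ^- 2 * (a / r)) => //.
by field.
Qed.

Lemma cont_addf f g x : {for x, continuous f} -> {for x, continuous g} ->
  {for x, continuous (fun y => f y + g y)}.
Proof. by move=> hf hg; exact: (@continuousD R _ 'rV[R]_n f g x hf hg). Qed.

Lemma cont_oppf f x : {for x, continuous f} -> {for x, continuous (fun y => - f y)}.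
Proof. by move=> hf; exact: (@continuousN R _ 'rV[R]_n f x hf). Qed.

Lemma cont_subf f g x : {for x, continuous f} -> {for x, continuous g} ->
  {for x, continuous (fun y => f y - g y)}.
Proof. by move=> hf hg; exact: (@continuousB R _ 'rV[R]_n f g x hf hg). Qed.

Lemma cont_mulf f g x : {for x, continuous f} -> {for x, continuous g} ->
  {for x, continuous (fun y => f y * g y)}.
Proof. by move=> hf hg; exact: (@continuousM R 'rV[R]_n f g x hf hg). Qed.

Lemma cont_cstf (c : R) x : {for x, continuous (fun=> c : R)}.
Proof. exact: cst_continuous. Qed.

Lemma cont_sqrf f x : {for x, continuous f} -> {for x, continuous (fun y => f y ^+ 2)}.
Proof. by move=> hf; exact: (@continuousM R 'rV[R]_n f f x hf hf). Qed.

Lemma cont_sumf (F : 'I_n -> 'rV[R]_n -> R) x :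
  (forall i, {for x, continuous (F i)}) ->
  {for x, continuous (fun y => \sum_(i < n) F i y)}.
Proof.
move=> h; rewrite /index_enum; elim: (Finite.enum _) => [|i s IH].
  rewrite (_ : (fun y => _) = (fun=> 0 : R)); first exact: cont_cstf.
  by apply/funext => y; rewrite big_nil.
rewrite (_ : (fun y => _) = (fun y => F i y + \sum_(j <- s) F j y)).
  exact: cont_addf.
by apply/funext => y; rewrite big_cons.
Qed.

Lemma cont_coord z x i : {for x, continuous (fun y : 'rV[R]_n => (y - z) ord0 i)}.
Proof.
rewrite (_ : (fun y : 'rV[R]_n => _) = (fun y : 'rV[R]_n => y ord0 i - z ord0 i)).
  by apply: cont_subf; [exact: coord_continuous|exact: cont_cstf].
by apply/funext => y; rewrite !mxE.
Qed.

Lemma cont_enorm z x : {for x, continuous (fun y : 'rV[R]_n => enorm (y - z))}.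
Proof. exact: enormB_continuous. Qed.

Lemma cont_inv_enorm z x : x <> z ->
  {for x, continuous (fun y : 'rV[R]_n => (enorm (y - z))^-1)}.
Proof.
move=> xz; apply: (@continuousV R 'rV[R]_n (fun y => enorm (y - z)) x).
  exact: lt0r_neq0 (enorm_sub_gt0 xz).
exact: cont_enorm.
Qed.

Lemma cont_dot z x : {for x, continuous (fun y : 'rV[R]_n => dot (y - z) (y - z))}.
Proof. by apply: cont_sumf => i; apply: cont_mulf; exact: cont_coord. Qed.

Lemma cont_near_eq f g x : (\forall y \near x, f y = g y) ->
  {for x, continuous f} -> {for x, continuous g}.
Proof.
move=> fg cf; have fgx := nbhs_singleton fg.
rewrite /prop_for/continuous_at -fgx; apply: cvg_trans cf.
exact: (@near_eq_cvg _ _ (nbhs x) _ f g fg).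
Qed.

End PointwiseRules.

(** * Twice continuously differentiable functions and test functions *)

Section C2.
Context {R : realType} {n : nat}.
Implicit Types (f : 'rV[R]_n -> R) (U : set 'rV[R]_n).

(** The candidates [P] and [Q] agree with the partial derivatives on [U] only; since [U] is open
    they agree near each of its points, which is enough to transfer derivatives and continuity. *)
Lemma C2_onI U f (P : 'I_n -> 'rV[R]_n -> R) (Q : 'I_n -> 'I_n -> 'rV[R]_n -> R) :
  open U ->
  (forall x, U x -> {for x, continuous f}) ->
  (forall i x, U x -> is_derive x (evec R i) f (P i x)) ->
  (forall i x, U x -> {for x, continuous (P i)}) ->
  (forall i j x, U x -> is_derive x (evec R j) (P i) (Q i j x)) ->
  (forall i j x, U x -> {for x, continuous (Q i j)}) ->
  C2_on U f /\
  (forall x, U x -> inf_laplacian f x =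
    \sum_(i < n) \sum_(j < n) Q i j x * P i x * P j x).
Proof.
move=> oU cf dP cP dQ cQ.
have nearU x : U x -> \forall y \near x, U y by move=> Ux; exact: open_nbhs_nbhs.
have PE i x : U x -> partial i f x = P i x by move=> /(dP i)/@derive_val.
have nPE i x : U x -> \forall y \near x, P i y = partial i f y.
  by move=> /nearU; apply: filterS => y /(PE i) ->.
have dP' i j x : U x -> is_derive x (evec R j) (partial i f) (Q i j x).
  by move=> Ux; apply: near_eq_is_derive (dQ i j x Ux); exact: nPE.
have QE i j x : U x -> partial j (partial i f) x = Q i j x.
  by move=> /(dP' i j)/@derive_val.
split; last first.
  by move=> x Ux; apply: eq_bigr => i _; apply: eq_bigr => j _; rewrite QE// !PE.
have within (g : 'rV[R]_n -> R) : (forall x, U x -> {for x, continuous g}) ->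
    {within U, continuous g}.
  by move=> h; apply: continuous_in_subspaceT => x /set_mem; exact: h.
split; first exact: within.
split=> [i|i j]; split.
- by move=> x /(dP i) [].
- by apply: within => x Ux; apply: cont_near_eq (cP i x Ux); exact: nPE.
- by move=> x /(dP' i j) [].
- apply: within => x Ux; apply: cont_near_eq (cQ i j x Ux).
  by apply: filterS (nearU x Ux) => y /(QE i j) ->.
Qed.

Lemma C2_on_cont U f x : open U -> C2_on U f -> U x ->
  [/\ {for x, continuous f}, (forall i, {for x, continuous (partial i f)}) &
      (forall i j, {for x, continuous (partial j (partial i f))})].
Proof.
move=> oU [cf [h1 h2]] Ux; split=> [|i|i j].
- exact: open_within_continuous cf Ux.
- by case: (h1 i) => _ c; exact: open_within_continuous c Ux.
- by case: (h2 i j) => _ c; exact: open_within_continuous c Ux.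
Qed.

Lemma C2_on_derive U f x : C2_on U f -> U x ->
  (forall i, is_derive x (evec R i) f (partial i f x)) /\
  (forall i j, is_derive x (evec R j) (partial i f) (partial j (partial i f) x)).
Proof.
move=> [cf [h1 h2]] Ux; split=> [i|i j]; apply: derivableP.
- by case: (h1 i) => c _; exact: c.
- by case: (h2 i j) => c _; exact: c.
Qed.

(** The operator is cubic, hence odd. Comparison from below thus reduces to comparison from above
    for [- u]. *)
Lemma visc_supersolN U f : visc_supersol U f -> visc_subsol U (fun y => - f y).
Proof.
move=> hf x phi Ux [W [oW Wx C2]] hmax.
have [C2N lapN] := @C2_onI W (fun y => - phi y) (fun i y => - partial i phi y)
  (fun i j y => - partial j (partial i phi) y) oW
  (fun x Wx => cont_oppf (let: And3 h _ _ := C2_on_cont oW C2 Wx in h))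
  (fun i x Wx => is_derive_oppf ((C2_on_derive C2 Wx).1 i))
  (fun i x Wx => cont_oppf (let: And3 _ h _ := C2_on_cont oW C2 Wx in h i))
  (fun i j x Wx => is_derive_oppf ((C2_on_derive C2 Wx).2 i j))
  (fun i j x Wx => cont_oppf (let: And3 _ _ h := C2_on_cont oW C2 Wx in h i j)).
have := hf x (fun y => - phi y) Ux; rewrite lapN//.
have -> : \sum_(i < n) \sum_(j < n) (- partial j (partial i phi) x * - partial i phi x *
    - partial j phi x) = - inf_laplacian phi x.
  rewrite /inf_laplacian -sumrN; apply: eq_bigr => i _; rewrite -sumrN.
  by apply: eq_bigr => j _; ring.
rewrite oppr_le0; apply; first by exists W.
by apply: filterS hmax => y; rewrite !opprK; lra.
Qed.

End C2.

(** * Comparison with cones *)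

Section Cones.
Context {R : realType} {n : nat}.
Implicit Types (x y z : 'rV[R]_n) (u : 'rV[R]_n -> R).

(* A perturbation of the cone [c + b |y - z|] that is strictly infinity-superharmonic when
   [g > 0], which the cone itself is not. *)
Definition bent_cone z (c b g : R) y := c + b * enorm (y - z) - g * dot (y - z) (y - z).

Lemma open_neq z : open [set y : 'rV[R]_n | y <> z].
Proof.
rewrite (_ : [set y | _] = ~` [set z])//; apply: closed_openC.
by apply: accessible_closed_set1; apply: hausdorff_accessible; exact: norm_hausdorff.
Qed.

Lemma bent_cone_cont z (c b g : R) y : {for y, continuous (bent_cone z c b g)}.
Proof.
rewrite /bent_cone; apply: cont_subf; first apply: cont_addf; first exact: cont_cstf.
  by apply: cont_mulf; [exact: cont_cstf|exact: cont_enorm].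
by apply: cont_mulf; [exact: cont_cstf|exact: cont_dot].
Qed.

(** For a radial function [F(r)] the infinity-Laplacian is [F'' F'^2]; here [F' = b - 2 g r] and
    [F'' = - 2 g]. *)
Lemma bent_cone_C2 z (c b g : R) : C2_on [set y | y <> z] (bent_cone z c b g) /\
  forall y, y <> z -> inf_laplacian (bent_cone z c b g) y =
    - (2 * g * (b - 2 * g * enorm (y - z)) ^+ 2).
Proof.
pose P i y := (b * (enorm (y - z))^-1 - 2 * g) * (y - z) ord0 i.
pose Q (i j : 'I_n) (y : 'rV[R]_n) :=
  (b * - ((y - z) ord0 j * ((enorm (y - z))^-1 * ((enorm (y - z))^-1 * (enorm (y - z))^-1))))
    * (y - z) ord0 i + (b * (enorm (y - z))^-1 - 2 * g) * (j == i)%:R.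
have [||||||C2 lap] := @C2_onI R n [set y | y <> z] (bent_cone z c b g) P Q.
- exact: open_neq.
- by move=> x _; exact: bent_cone_cont.
- move=> i x xz; rewrite /bent_cone; apply: is_derive_eq.
    exact: is_derive_subf (is_derive_addf (is_derive_cstf c x _)
      (is_derive_scalef b (is_derive_enorm (evec R i) xz)))
      (is_derive_scalef g (is_derive_sqr_enorm z x (evec R i))).
  by rewrite dot_evec /P; ring.
- move=> i x xz; apply: cont_mulf; last exact: cont_coord.
  apply: cont_subf; last exact: cont_cstf.
  by apply: cont_mulf; [exact: cont_cstf|exact: cont_inv_enorm].
- move=> i j x xz; apply: is_derive_eq.
    exact: is_derive_mulf (is_derive_subf
      (is_derive_scalef b (is_derive_inv_enorm (evec R j) xz))
      (is_derive_cstf (2 * g) x _)) (is_derive_coord z x _ i).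
  rewrite subr0 dot_evec evecE /Q; congr (_ * - (_ * _) * _ + _).
  by rewrite -!invfM !exprS expr0 mulr1.
- move=> i j x xz; have ci := cont_inv_enorm xz.
  apply: cont_addf; apply: cont_mulf; try exact: cont_cstf; try exact: cont_coord.
    apply: cont_mulf; first exact: cont_cstf.
    apply: cont_oppf; apply: cont_mulf; first exact: cont_coord.
    by do 2?apply: cont_mulf.
  by apply: cont_subf; [apply: cont_mulf; [exact: cont_cstf|]|exact: cont_cstf].
split=> // y yz; rewrite lap//.
set r := enorm (y - z); have r0 : r != 0 by exact: lt0r_neq0 (enorm_sub_gt0 yz).
pose k := b * r^-1 - 2 * g; pose q (i : 'I_n) : R := (y - z) ord0 i.
have qq : \sum_(i < n) q i * q i = r ^+ 2 by rewrite sqr_enorm.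
have inner (i : 'I_n) : \sum_(j < n) Q i j y * P i y * P j y =
    k ^+ 2 * (k - b / r) * (q i * q i).
  rewrite (eq_bigr (fun j : 'I_n => - (k ^+ 2 * b * r ^- 3 * (q i * q i)) * (q j * q j)
     + (if j == i then k ^+ 3 * (q i * q i) else 0))); last first.
    move=> j _; rewrite /Q /P -/r -/k -!/(q _) -!invfM.
    have -> : r * (r * r) = r ^+ 3 by ring.
    by move: (r ^+ 3)^-1 => r3; case: eqP => [->|_] /=; ring.
  rewrite big_split/= -mulr_sumr qq -big_mkcond big_pred1_eq.
  by field.
under eq_bigr do rewrite inner.
rewrite -mulr_sumr qq /k; field.
exact: r0.
Qed.

(** If [u] exceeded the cone somewhere, its difference with a slightly bent cone would have an
    interior maximum, where the test function has negative infinity-Laplacian. *)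
Lemma cone_comparison (W : set 'rV[R]_n) u z (a b : R) :
  open W -> bounded_set W -> ~ W z -> b != 0 ->
  {within closure W, continuous u} -> visc_subsol W u ->
  (forall y, closure W y -> ~ W y -> u y <= a + b * enorm (y - z)) ->
  forall y, W y -> u y <= a + b * enorm (y - z).
Proof.
move=> oW bW Wz b0 cu su hb x Wx; rewrite leNgt; apply/negP => gap.
have [M0 hM0] := @bounded_enorm _ _ W z bW.
have M00 : 0 <= M0 by apply: le_trans (hM0 _ Wx); exact: enorm_ge0.
have clM y : closure W y -> enorm (y - z) <= M0 by exact: closure_enorm_le.
have cW : compact (closure W).
  apply: bounded_closed_compact; last exact: closed_closure.
  exact: enorm_bounded clM.
pose d := u x - (a + b * enorm (x - z)).
have d0 : 0 < d by rewrite subr_gt0.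
(* The first bound keeps [u - phi] positive at [x]; the second keeps the radial slope [b - 2 g r]
   away from zero on [W]. *)
pose g := Num.min (d / (2 * (M0 ^+ 2 + 1))) (`|b| / (4 * (M0 + 1))).
have M1 : 0 < M0 ^+ 2 + 1 by rewrite ltr_wpDl// sqr_ge0.
have M2 : 0 < M0 + 1 by rewrite ltr_wpDl.
have g0 : 0 < g by rewrite lt_min !divr_gt0 ?normr_gt0 ?mulr_gt0.
have g1 : g * (M0 ^+ 2 + 1) <= d / 2.
  by rewrite -ler_pdivlMr// -mulrA -invfM ge_min lexx.
have g2 : g * (M0 + 1) <= `|b| / 4.
  by rewrite -ler_pdivlMr// -mulrA -invfM ge_min lexx orbT.
(* The constant is raised by [g * M0 ^+ 2] so that [phi] lies above the cone on the closure of [W];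
   a positive maximum of [u - phi] is then interior. *)
pose phi := bent_cone z (a + g * M0 ^+ 2) b g.
have phiE y : phi y = a + b * enorm (y - z) + g * (M0 ^+ 2 - enorm (y - z) ^+ 2).
  by rewrite /phi /bent_cone sqr_enorm; ring.
have cl0 : closure W !=set0 by exists x; exact: subset_closure.
have cphi : {within closure W, continuous (fun y => u y - phi y)}.
  apply: within_continuousB => //.
  by apply: continuous_subspaceT => y; exact: bent_cone_cont.
have [c /set_mem Wc hc] := compact_EVT_max cl0 cW cphi.
have cpos : 0 < u c - phi c.
  apply: lt_le_trans (hc x _); last by apply: mem_set; exact: subset_closure.
  have hB : 0 <= g * enorm (x - z) ^+ 2 by rewrite mulr_ge0 ?sqr_ge0// ltW.
  rewrite phiE opprD addrA -/d; move: hB g0 g1 d0; clear.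
  by move: (g) (d) (enorm _ ^+ 2) (M0 ^+ 2) => *; lra.
have {}Wc' : W c.
  apply: contrapT => nWc; move: cpos; rewrite phiE ltNge subr_le0 => /negP; apply.
  apply: le_trans (hb c Wc nWc) _; rewrite lerDl mulr_ge0 ?(ltW g0)// subr_ge0.
  by rewrite ler_pXn2r ?nnegrE ?enorm_ge0// clM.
have cz : c <> z by move=> E; apply: Wz; rewrite -E.
have [C2 lap] := bent_cone_C2 z (a + g * M0 ^+ 2) b g.
have := su c phi Wc' _ _; rewrite lap// => /(_ _ _).
have bne : b - 2 * g * enorm (c - z) != 0.
  have b1 : 0 < `|b| by rewrite normr_gt0.
  have lt_b : 2 * g * enorm (c - z) < `|b|.
    have := clM c Wc; move: g0 g2 b1 (enorm_ge0 (c - z)); clear.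
    by move: (g) (enorm _) `|b| => *; nra.
  rewrite subr_eq0; apply/negP => /eqP bE; move: lt_b; rewrite -bE ger0_norm ?ltxx//.
  by rewrite bE !mulr_ge0 ?enorm_ge0// ltW.
have pos : 0 < 2 * g * (b - 2 * g * enorm (c - z)) ^+ 2.
  by apply: mulr_gt0; [exact: mulr_gt0|rewrite exprn_even_gt0].
rewrite leNgt oppr_lt0 pos => h; apply: notF; apply: h.
  by exists [set y | y <> z]; split => //; exact: open_neq.
have : \forall y \near c, W y by exact: open_nbhs_nbhs.
by apply: filterS => y Wy; apply: hc; apply: mem_set; exact: subset_closure.
Qed.

End Cones.

(** * Perpendicular directions *)

Section Perp.
Context {R : realType} {n : nat}.
Implicit Types a b e : 'rV[R]_n.

Lemma enorm_normalize a : a != 0 -> enorm ((enorm a)^-1 *: a) = 1.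
Proof.
move=> a0; rewrite enormZ ger0_norm ?invr_ge0 ?enorm_ge0// mulVf//.
by rewrite enorm_eq0.
Qed.

(** The vector [z] is a halfway direction: both the turn from [e] to [z] and that from [z] to [b]
    are at most a right angle. *)
Lemma exists_perp e b : (2 <= n)%N ->
  exists z, [/\ enorm z = 1, dot z e = 0 & 0 <= dot z b].
Proof.
move=> n2.
suff [w w0 we] : exists2 w, w != 0 & dot w e = 0.
  pose z := (enorm w)^-1 *: w.
  have z1 : enorm z = 1 by exact: enorm_normalize.
  have ze : dot z e = 0 by rewrite dotZl we mulr0.
  have [zb|/ltW zb] := leP 0 (dot z b); first by exists z.
  by exists (- z); rewrite enormN z1 !dotNl ze oppr0 oppr_ge0.
have [e0|e0] := eqVneq e 0.
  exists (evec R (Ordinal (ltn_trans (isT : (0 < 1)%N) n2))).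
    by rewrite -enorm_gt0 enorm_evec.
  by rewrite e0 dot0r.
have [i ei] : exists i, e ord0 i != 0.
  apply/existsP; apply: contraT; rewrite negb_exists => /forallP h.
  by case/eqP: e0; apply/rowP => i; rewrite mxE; apply/eqP; rewrite -[_ == _]negbK h.
have [j ij] : exists j : 'I_n, i != j.
  have [i0|i0] := eqVneq (val i) 0%N.
    by exists (Ordinal n2); rewrite -val_eqE/= i0.
  by exists (Ordinal (ltn_trans (isT : (0 < 1)%N) n2)); rewrite -val_eqE/=.
(* A quarter turn of the projection of [e] to the plane of coordinates [i] and [j]. *)
exists (e ord0 i *: evec R j - e ord0 j *: evec R i); last first.
  by rewrite !dotE !(dotC (evec _ _)) !dot_evec mulrC subrr.
apply/eqP => /rowP/(_ j); rewrite !mxE eqxx (negbTE ij) mulr1 mulr0 subr0.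
by apply/eqP.
Qed.

Lemma bounded_set_sub (A B : set 'rV[R]_n) : A `<=` B -> bounded_set B -> bounded_set A.
Proof.
move=> AB /(bounded_enorm 0)[M hM]; apply: (@enorm_bounded _ _ _ 0 M) => x /AB.
exact: hM.
Qed.

End Perp.

(** * Cone bounds for the potential *)

Section Potential.
Context {R : realType} {n : nat}.
Variables (O : set 'rV[R]_n) (x0 : 'rV[R]_n) (u : 'rV[R]_n -> R).
Hypotheses (n2 : (2 <= n)%N) (oO : open O) (bO : bounded_set O) (Ox0 : O x0).
Hypothesis hu : inf_harmonic_potential O x0 u.
Implicit Types x y z : 'rV[R]_n.

Let bdry := closure O `\` O.
Let Om := O `\ x0.

Let cu : {within closure O, continuous u}. Proof. by case: hu. Qed.
Let u_bdry y : bdry y -> u y = 0. Proof. by case: hu => _ _ h _ /h. Qed.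
Let u_x0 : u x0 = 1. Proof. by case: hu. Qed.
Let u_sub : visc_subsol Om u. Proof. by case: hu => _ [_ []]. Qed.
Let u_super : visc_subsol Om (fun y => - u y).
Proof. by case: hu => _ [_ [_ h]] _ _; exact: visc_supersolN. Qed.

Lemma open_punctured : open Om.
Proof. by rewrite /Om setDE; apply: openI => //; exact: open_neq. Qed.

(** The parameters at which the segment is outside [O] form a compact set; its least element is a
    limit of points of [O]. *)
Lemma exit_point x y : O x -> ~ O y ->
  exists2 s : R, 0 < s <= 1 & bdry (x + s *: (y - x)).
Proof.
move=> Ox Oy; pose l (s : R) := x + s *: (y - x).
have lc s : {for s, continuous l} by exact: shift_line_continuous.
pose S := `[(0 : R), 1]%classic `&` l @^-1` (~` O).
have cS : compact S.
  apply: compact_closedI; first exact: segment_compact.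
  by apply: closed_comp => [s _|]; [exact: lc|exact: open_closedC].
have S0 : S !=set0.
  by exists 1; split; rewrite /= ?in_itv/= ?ler01 ?lexx// /l scale1r addrC subrK.
have [|s /set_mem[]] := @compact_EVT_min _ R (fun s : R => s) S S0 cS.
  by apply: continuous_subspaceT => s; exact: cvg_id.
rewrite /= in_itv/= => /andP[s0 s1] Os smin.
have {}s0 : 0 < s.
  rewrite lt_neqAle s0 andbT; apply/eqP => s0'; apply: Os.
  by rewrite /l -s0' scale0r addr0.
exists s; first by rewrite s0.
split=> // B /lc; rewrite nbhs_simpl/= => /nbhs_ballP[e /= e0 he].
pose t := Num.max (s - e / 2) (s / 2).
have ts : t < s by rewrite gt_max; apply/andP; split; lra.
have t0 : 0 < t by rewrite lt_max (divr_gt0 s0)// orbT.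
exists (l t); split; last first.
  apply: he; rewrite /ball/= ger0_norm ?subr_ge0 ?(ltW ts)//.
  have : s - e / 2 <= t by rewrite le_max lexx.
  by move: e0; lra.
apply: contrapT => Ot.
have : s <= t by apply: smin; apply: mem_set; split => //=; rewrite in_itv/=; lra.
by rewrite leNgt ts.
Qed.

Lemma closure_compact : compact (closure O).
Proof.
have [M hM] := bounded_enorm 0 bO.
apply: bounded_closed_compact; last exact: closed_closure.
by apply: (@enorm_bounded _ _ _ 0 M); exact: closure_enorm_le.
Qed.

Lemma nearest_boundary_point : exists2 y, bdry y &
  forall z, bdry z -> enorm (y - x0) <= enorm (z - x0).
Proof.
have [M hM] := bounded_enorm x0 bO.
(* Boundedness gives a point outside [O], and the segment to it from [x0] shows that the boundary is
   nonempty. *)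
pose i0 := Ordinal (ltn_trans (isT : (0 < 1)%N) n2).
have Oout : ~ O (x0 + (M + 1) *: evec R i0).
  move=> /hM; rewrite addrAC subrr add0r enormZ enorm_evec mulr1.
  by have := ler_norm (M + 1); lra.
have [s _ bs] := exit_point Ox0 Oout.
have [|||y [by_ ymin]] := @compact_min _ _ bdry (fun y => enorm (y - x0)).
- rewrite /bdry setDE; apply: compact_closedI; first exact: closure_compact.
  exact: open_closedC.
- by eexists; exact: bs.
- by move=> y _; exact: cont_enorm.
by exists y.
Qed.

Lemma punctured_closure y : closure Om y -> ~ Om y -> bdry y \/ y = x0.
Proof.
move=> cy Omy; have [->|/eqP yx] := eqVneq y x0; [by right|left]; split.
  by move: y cy {Omy yx}; apply: closure_subset => z [].
by move=> Oy; apply: Omy; split.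
Qed.

Let bOm : bounded_set Om.
Proof. by apply: bounded_set_sub bO => z []. Qed.

Let cuOm : {within closure Om, continuous u}.
Proof.
apply: continuous_subspaceW cu; apply: closure_subset => z [].
by [].
Qed.

(** The boundary of the punctured domain consists of [bdry] and the pole, which gives one condition
    on each. The vertex may be the pole. *)
Lemma potential_le (a b : R) z : ~ Om z -> b != 0 ->
  (forall y, bdry y -> 0 <= a + b * enorm (y - z)) -> 1 <= a + b * enorm (x0 - z) ->
  forall y, O y -> u y <= a + b * enorm (y - z).
Proof.
move=> Oz b0 hb hx y Oy; have [->|/eqP yx] := eqVneq y x0; first by rewrite u_x0.
apply: (@cone_comparison _ _ Om) => //; first exact: open_punctured.
by move=> w cw /(punctured_closure cw)[bw|->]; rewrite ?u_x0// u_bdry// hb.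
Qed.

Lemma potential_ge (a b : R) z : ~ Om z -> b != 0 ->
  (forall y, bdry y -> a + b * enorm (y - z) <= 0) -> a + b * enorm (x0 - z) <= 1 ->
  forall y, O y -> a + b * enorm (y - z) <= u y.
Proof.
move=> Oz b0 hb hx y Oy; have [->|/eqP yx] := eqVneq y x0; first by rewrite u_x0.
suff : - u y <= (- a) + (- b) * enorm (y - z) by move: (enorm _) => r; lra.
apply: (@cone_comparison _ _ Om (fun w => - u w)) => //.
- exact: open_punctured.
- by rewrite oppr_eq0.
- by move=> w; apply: continuousN; exact: cuOm.
move=> w cw /(punctured_closure cw)[bw|->]; rewrite ?u_x0.
  by rewrite u_bdry//; have := hb w bw; move: (enorm _) => r; lra.
by move: hx; move: (enorm _) => r; lra.
Qed.

Let x0Om : ~ Om x0. Proof. by move=> [_]; apply. Qed.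

(** A constant would be a cone of slope zero, which [cone_comparison] excludes; cones at [x0] with
    arbitrarily small slope take its place, here and in [potential_ge0]. *)
Lemma potential_le1 y : O y -> u y <= 1.
Proof.
move=> Oy; apply/ler_addgt0Pr => e e0.
have M0 : 0 < enorm (y - x0) + 1 by rewrite ltr_wpDl// enorm_ge0.
apply: le_trans (@potential_le 1 (e / (enorm (y - x0) + 1)) x0 _ _ _ _ y Oy) _ => //.
- by rewrite mulf_neq0 ?invr_eq0 ?gt_eqF.
- by move=> z _; rewrite addr_ge0// mulr_ge0 ?enorm_ge0// ltW// divr_gt0.
- by rewrite lerDl mulr_ge0 ?enorm_ge0// ltW// divr_gt0.
by rewrite lerD2l mulrAC ler_pdivrMr// ler_pM2l// lerDl.
Qed.

Lemma potential_ge0 y : O y -> 0 <= u y.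
Proof.
move=> Oy; rewrite -oppr_le0; apply/ler_addgt0Pr => e e0; rewrite add0r lerNl.
have M0 : 0 < enorm (y - x0) + 1 by rewrite ltr_wpDl// enorm_ge0.
apply: le_trans (@potential_ge 0 (- (e / (enorm (y - x0) + 1))) x0 _ _ _ _ y Oy) => //.
- by rewrite add0r mulNr lerN2 mulrAC ler_pdivrMr// ler_pM2l// lerDl.
- by rewrite oppr_eq0 mulf_neq0 ?invr_eq0 ?gt_eqF.
- by move=> z _; rewrite add0r mulNr oppr_le0 mulr_ge0 ?enorm_ge0// ltW// divr_gt0.
by rewrite subrr enorm0 mulr0 addr0.
Qed.

Variable ys : 'rV[R]_n.
Hypotheses (bys : bdry ys) (ysmin : forall z, bdry z -> enorm (ys - x0) <= enorm (z - x0)).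
Let d := enorm (ys - x0).

Lemma inradius_gt0 : 0 < d.
Proof. by apply: enorm_sub_gt0 => E; case: bys; rewrite E. Qed.

Lemma inball_sub y : enorm (y - x0) < d -> O y.
Proof.
move=> yd; apply: contrapT => Oy; have [s /andP[s0 s1] /ysmin] := exit_point Ox0 Oy.
rewrite addrAC subrr add0r enormZ gtr0_norm// -/d.
by have := enorm_ge0 (y - x0); move: yd s0 s1; move: (enorm _) d => r d'; nra.
Qed.

Lemma potential_ge_cone y : O y -> 1 - d^-1 * enorm (y - x0) <= u y.
Proof.
move=> Oy; rewrite -mulNr; apply: potential_ge => //.
- by rewrite oppr_eq0 invr_eq0 gt_eqF ?inradius_gt0.
- move=> z /ysmin zd; rewrite mulNr subr_le0 ler_pdivlMl ?inradius_gt0//.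
  by rewrite mulr1.
- by rewrite subrr enorm0 mulr0 addr0.
Qed.

(** The lower cone with vertex [x0] and the upper cone of slope [d^-1] with vertex [ys] coincide on
    the segment joining them. *)
Lemma potential_on_segment (s : R) : 0 <= s < 1 -> u (x0 + s *: (ys - x0)) = 1 - s.
Proof.
move=> /andP[s0 s1]; have d0 := inradius_gt0.
have Os : O (x0 + s *: (ys - x0)).
  by apply: inball_sub; rewrite addrAC subrr add0r enormZ ger0_norm// -/d gtr_pMl.
apply/eqP; rewrite eq_le; apply/andP; split.
  apply: le_trans (@potential_le 0 d^-1 ys _ _ _ _ _ Os) _.
  - by case: bys => _ nO [].
  - by rewrite invr_eq0 gt_eqF.
  - by move=> y _; rewrite add0r mulr_ge0 ?enorm_ge0// invr_ge0 ltW.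
  - by rewrite add0r enormB -/d mulVf// gt_eqF.
  have -> : x0 + s *: (ys - x0) - ys = (s - 1) *: (ys - x0).
    by rewrite scalerBl scale1r opprB addrCA addrA addrC addrA.
  rewrite add0r enormZ -/d ler0_norm ?subr_le0 ?(ltW s1)// opprB mulrCA mulVf ?mulr1//.
  by rewrite gt_eqF.
apply: le_trans (potential_ge_cone Os).
rewrite addrAC subrr add0r enormZ ger0_norm// -/d mulrCA mulVf ?mulr1//.
by rewrite gt_eqF.
Qed.

(** Comparison with the cone of slope [d^-1] and vertex [x], off [x] and the pole; the condition at
    the pole is [potential_ge_cone] at [x]. *)
Lemma potential_lipschitz x y : O x -> O y -> u y <= u x + d^-1 * enorm (y - x).
Proof.
move=> Ox Oy; have d0 := inradius_gt0.
have [->|/eqP xx0] := eqVneq x x0.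
  by rewrite u_x0 (le_trans (potential_le1 Oy))// lerDl mulr_ge0 ?enorm_ge0// invr_ge0 ltW.
have [->|/eqP yx0] := eqVneq y x0.
  by have := potential_ge_cone Ox; rewrite u_x0 (enormB x0); lra.
have [->|/eqP yx] := eqVneq y x; first by rewrite subrr enorm0 mulr0 addr0.
pose W := Om `\ x.
have WOm : W `<=` Om by move=> z [].
apply: (@cone_comparison _ _ W) => //.
- by rewrite /W setDE; apply: openI; [exact: open_punctured|exact: open_neq].
- exact: bounded_set_sub bOm.
- by move=> [_]; apply.
- by rewrite invr_eq0 gt_eqF.
- by apply: continuous_subspaceW cuOm; exact: closure_subset.
- by move=> z phi /WOm; exact: u_sub.
move=> w cw nW; have cw' : closure Om w by move: w cw {nW}; apply: closure_subset.
have [->|/eqP wx] := eqVneq w x; first by rewrite subrr enorm0 mulr0 addr0.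
have [bw|->] := punctured_closure cw' (fun h => nW (conj h wx)).
  by rewrite u_bdry// addr_ge0 ?potential_ge0// mulr_ge0 ?enorm_ge0// invr_ge0 ltW.
by have := potential_ge_cone Ox; rewrite u_x0 (enormB x0); lra.
Qed.

(** The sphere about [x] through the pole lies in [O], because [2 * enorm (x - x0) < d]. The slope
    is chosen so that the cone with vertex [x] takes the value 1 there, and [u <= 1]. *)
Lemma potential_ball_slope x y : 2 * enorm (x - x0) < d -> u x < 1 ->
  enorm (y - x) < enorm (x - x0) ->
  u y <= u x + (1 - u x) / enorm (x - x0) * enorm (y - x).
Proof.
move=> xd ux yx; have xx0 : x <> x0 by move=> E; move: ux; rewrite E u_x0 ltxx.
have r0 := enorm_sub_gt0 xx0.
have [->|/eqP yx'] := eqVneq y x; first by rewrite subrr enorm0 mulr0 addr0.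
pose W := eball x (enorm (x - x0)) `\ x.
have clW z : closure W z -> enorm (z - x) <= enorm (x - x0).
  by apply: closure_enorm_le => {}z [/ltW].
have clO z : closure W z -> O z.
  move=> /clW zx; apply: inball_sub; apply: le_lt_trans xd.
  by apply: le_trans (ler_enorm_trans z x x0) _; lra.
have WOm : W `<=` Om.
  move=> z Wz; split; first by apply: clO; exact: subset_closure.
  by move=> E; case: Wz; rewrite /eball/= E enormB ltxx.
apply: (@cone_comparison _ _ W) => //.
- by rewrite /W setDE; apply: openI; [exact: open_eball|exact: open_neq].
- exact: bounded_set_sub bOm.
- by move=> [_]; apply.
- by rewrite mulf_neq0 ?invr_eq0 ?gt_eqF// subr_gt0.
- by apply: continuous_subspaceW cuOm; exact: closure_subset.
- by move=> z phi /WOm; exact: u_sub.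
move=> w cw nW; have [->|/eqP wx] := eqVneq w x.
  by rewrite subrr enorm0 mulr0 addr0.
have -> : enorm (w - x) = enorm (x - x0).
  apply/eqP; rewrite eq_le clW//= leNgt; apply/negP => h; apply: nW.
  by split.
rewrite divfK ?gt_eqF// addrC subrK; apply: potential_le1; exact: clO.
Qed.

End Potential.

(** * Asymptotic slope at the pole *)

Section Blowup.
Context {R : realType} {n : nat}.
Variables (x0 : 'rV[R]_n) (u : 'rV[R]_n -> R) (d : R).
Hypotheses (n2 : (2 <= n)%N) (d0 : 0 < d).
Hypothesis u_le1 : forall y, enorm (y - x0) < d -> u y <= 1.
Hypothesis u_slope : forall x y, 2 * enorm (x - x0) < d -> u x < 1 ->
  enorm (y - x) < enorm (x - x0) ->
  u y <= u x + (1 - u x) / enorm (x - x0) * enorm (y - x).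
Implicit Types a b e : 'rV[R]_n.

(** Slope of the cone with vertex [x0] and height 1 through the point at radius [r] in direction
    [a]. *)
Let q (r : R) a := (1 - u (x0 + r *: a)) / r.

(* Loss of slope at most a factor [1 - A (1 - cos)] when the direction turns by an angle
   and the radius shrinks by [s]. *)
Let turn (A s : R) := forall a b (r t : R), enorm a = 1 -> enorm b = 1 ->
  0 <= dot a b -> 0 < r -> 2 * r < d -> 0 < t <= s * r ->
  q r a * (1 - A * (1 - dot a b)) <= q t b.

Let enorm_ray r a : 0 <= r -> enorm a = 1 -> enorm (x0 + r *: a - x0) = r.
Proof.
by move=> r0 a1; rewrite addrAC subrr add0r enormZ a1 mulr1 ger0_norm.
Qed.

Let q_ge0 r a : enorm a = 1 -> 0 < r < d -> 0 <= q r a.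
Proof.
move=> a1 /andP[r0 rd]; rewrite divr_ge0 ?(ltW r0)// subr_ge0 u_le1//.
by rewrite enorm_ray// ltW.
Qed.

Let dot_le1 a b : enorm a = 1 -> enorm b = 1 -> dot a b <= 1.
Proof. by move=> a1 b1; have := dot_le_enorm a b; rewrite a1 b1 mulr1. Qed.

(** With [x] at radius [r] and [y] at radius [t], the cone at [x] gives
    [1 - u y >= q r a * (r - |y - x|)], and [t <= r / 2] gives
    [|y - x| <= r - t + 2 t (1 - cos)]. *)
Let turn_base : turn 2 2^-1.
Proof.
move=> a b r t a1 b1 ab r0 rd /andP[t0 tr].
have qt : 0 <= q t b by apply: q_ge0 => //; rewrite t0/=; lra.
have qr : 0 <= q r a by apply: q_ge0 => //; rewrite r0/=; lra.
have ab1 := dot_le1 a1 b1.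
(* When the cosine is at most 1/2 the claimed lower bound is nonpositive; otherwise [y] falls in the
   ball where [u_slope] applies. *)
have [ab2|ab2] := leP (dot a b) 2^-1; first by apply: le_trans qt; nra.
have [u1|u1] := leP 1 (u (x0 + r *: a)).
  apply: le_trans qt; apply: mulr_le0_ge0; last by lra.
  by rewrite /q pmulr_lle0 ?invr_gt0// subr_le0.
pose x := x0 + r *: a; pose y := x0 + t *: b.
have yxE : enorm (y - x) ^+ 2 = (r - t) ^+ 2 + 2 * r * t * (1 - dot a b).
  have -> : y - x = t *: b - r *: a by rewrite opprD addrACA subrr add0r.
  by rewrite sqr_enorm !dotE -!sqr_enorm a1 b1 (dotC b a); ring.
have xr : enorm (x - x0) = r by rewrite enorm_ray// ltW.
have := @u_slope x y; rewrite xr => /(_ rd u1).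
have yx_ge0 := enorm_ge0 (y - x).
have yxr : enorm (y - x) < r.
  rewrite -(@ltr_pXn2r _ 2%N) ?nnegrE ?(ltW r0)// yxE.
  have rc : 0 < r * (dot a b - 2^-1) by rewrite mulr_gt0// subr_gt0.
  have : 0 < t * (2 * r * dot a b - t) by rewrite mulr_gt0//; lra.
  by lra.
have yx_le : enorm (y - x) <= r - t + 2 * t * (1 - dot a b).
  rewrite -(@ler_pXn2r _ 2%N) ?nnegrE// ?yxE; last by nra.
  by have : 0 <= t * (1 - dot a b) by [nra]; nra.
move=> /(_ yxr); rewrite -/(q r a).
have -> : u x = 1 - r * q r a by rewrite /q mulrCA mulfV ?gt_eqF// mulr1; lra.
have -> : u y = 1 - t * q t b by rewrite /q mulrCA mulfV ?gt_eqF// mulr1; lra.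
move=> h; rewrite -(ler_pM2l t0).
have : q r a * enorm (y - x) <= q r a * (r - t + 2 * t * (1 - dot a b)).
  by rewrite ler_wpM2l.
by move: h; move: (q r a) (q t b) (enorm (y - x)) (dot a b) => *; lra.
Qed.

(* The intermediate direction is the normalized midpoint, which halves the angle:
   [1 - cos (w / 2) <= 3/10 (1 - cos w)] for [0 <= w <= pi / 2]. *)
Let turn_step (A s : R) : 0 <= A <= 2 -> 0 < s <= 1 -> turn A s ->
  turn (3 / 5 * A) (s * s).
Proof.
move=> /andP[A0 A2] /andP[s0 s1] hA a b r t a1 b1 ab r0 rd /andP[t0 ts].
have ab1 := dot_le1 a1 b1.
pose N := enorm (a + b).
have N2 : N ^+ 2 = 2 + 2 * dot a b.
  by rewrite sqr_enorm !dotE -!sqr_enorm a1 b1 (dotC b a); ring.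
have N0 : 0 < N.
  by rewrite lt_neqAle enorm_ge0 andbT; apply/eqP => E; move: N2; rewrite -E expr0n/=; lra.
pose m := N^-1 *: (a + b).
have m1 : enorm m = 1 by apply: enorm_normalize; rewrite -enorm_gt0.
have am : dot a m = N / 2.
  rewrite dotZr dotDr -sqr_enorm a1 expr1n.
  have -> : 1 + dot a b = N ^+ 2 / 2 by rewrite N2; lra.
  by rewrite expr2 -mulrA mulKf// gt_eqF.
have mb : dot m b = N / 2.
  rewrite dotZl dotDl -(sqr_enorm b) b1 expr1n.
  have -> : dot a b + 1 = N ^+ 2 / 2 by rewrite N2; lra.
  by rewrite expr2 -mulrA mulKf// gt_eqF.
have loss : 1 - N / 2 <= 3 / 10 * (1 - dot a b) by nra.
have N1 : 0 <= N / 2 by lra.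
have sr : 0 < s * r by rewrite mulr_gt0.
have sr2 : 2 * (s * r) < d by apply: le_lt_trans rd; nra.
have h1 := hA a m r (s * r) a1 m1.
rewrite am sr lexx in h1; have {}h1 := h1 N1 r0 rd isT.
have h2 := hA m b (s * r) t m1 b1.
rewrite mb t0 (mulrA s s r) ts in h2; have {}h2 := h2 N1 sr sr2 isT.
have qr : 0 <= q r a by apply: q_ge0 => //; rewrite r0/=; lra.
have qs : 0 <= q (s * r) m by apply: q_ge0 => //; rewrite sr/=; lra.
(* Each half turn loses at most the factor [1 - l], and [(1 - l) ^+ 2 >= 1 - 2 l], where [2 l] is
   the loss allowed for the full turn. *)
set l := 3 / 10 * A * (1 - dot a b).
have l0 : 0 <= l by rewrite /l; nra.
have l1 : l <= 1 by rewrite /l; nra.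
have lN : A * (1 - N / 2) <= l by rewrite /l; nra.
have g1 : q r a * (1 - l) <= q (s * r) m.
  by apply: le_trans h1; rewrite ler_wpM2l//; lra.
have g2 : q (s * r) m * (1 - l) <= q t b.
  by apply: le_trans h2; rewrite ler_wpM2l//; lra.
apply: le_trans g2; apply: (@le_trans _ _ (q r a * (1 - l) * (1 - l))); last first.
  by rewrite ler_wpM2r//; lra.
rewrite -(mulrA (q r a)) ler_wpM2l//.
have -> : 3 / 5 * A * (1 - dot a b) = 2 * l by rewrite /l; lra.
by nra.
Qed.

(** Each bisection of the angle multiplies the loss constant by 3/5, at the price of squaring the
    shrinking factor of the radius. *)
Let turn_small (A : R) : 0 < A -> exists2 s, 0 < s <= 1 & turn A s.
Proof.
move=> A0.
have iter k : exists2 s, 0 < s <= 1 & turn (2 * (3 / 5) ^+ k) s.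
  elim: k => [|k [s /andP[s0 s1] hs]].
    by exists 2^-1; [lra|rewrite expr0 mulr1; exact: turn_base].
  exists (s * s); first by nra.
  rewrite exprS mulrCA; apply: turn_step => //; last by rewrite s0.
  have p1 : 0 <= (3 / 5 : R) ^+ k <= 1.
    by rewrite exprn_ge0 ?exprn_ile1//; lra.
  by case/andP: p1 => *; lra.
have : (fun k => (3 / 5 : R) ^+ k) @ \oo --> (0 : R).
  by apply: cvg_expr; rewrite ger0_norm; lra.
move=> /cvgrPdist_lt /(_ (A / 2)); rewrite divr_gt0// => /(_ isT) [k _ /(_ k (leqnn k))].
rewrite /= sub0r normrN ger0_norm ?exprn_ge0//.
move=> hk; have [s s01 hs] := iter k; exists s => // a b r t a1 b1 ab r0 rd ts.
apply: le_trans (hs a b r t a1 b1 ab r0 rd ts); rewrite ler_wpM2l//.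
  by apply: q_ge0 => //; rewrite r0/=; lra.
by have := dot_le1 a1 b1; move: hk; move: (_ ^+ k) => c; nra.
Qed.

Variable e : 'rV[R]_n.
Hypothesis e1 : enorm e = 1.
Hypothesis u_ray : forall r : R, 0 < r < d -> u (x0 + r *: e) = 1 - d^-1 * r.

(** The slope is exactly [d^-1] along [e]. Turning from [e] to a perpendicular [z], then from [z] to
    the direction of [x], loses at most a factor [1 - A] each time. *)
Lemma blowup_cone (eps : R) : 0 < eps -> exists2 r0 : R, 0 < r0 &
  forall x, 0 < enorm (x - x0) < r0 ->
    (d^-1 - eps) * enorm (x - x0) <= 1 - u x.
Proof.
move=> eps0; pose A := Num.min 1 (eps * d / 2).
have A0 : 0 < A by rewrite lt_min ltr01/= !mulr_gt0.
have A1 : A <= 1 by rewrite ge_min lexx.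
have A2 : A <= eps * d / 2 by rewrite ge_min lexx orbT.
have [s /andP[s0 s1] hs] := turn_small A0.
have d4 : 0 < d / 4 by rewrite divr_gt0.
(* The turns start at radius [d / 4], and each of the two shrinks the radius by [s]. *)
exists (s * (s * (d / 4))); first by rewrite !mulr_gt0.
move=> x /andP[t0 tr]; set t := enorm (x - x0) in t0 tr *.
pose b := t^-1 *: (x - x0).
have b1 : enorm b = 1 by apply: enorm_normalize; rewrite -enorm_gt0.
have xE : x = x0 + t *: b by rewrite scalerA mulfV ?gt_eqF// scale1r addrC subrK.
have [z [z1 ze zb]] := exists_perp e b n2.
have qe : q (d / 4) e = d^-1.
  rewrite /q u_ray; last by rewrite d4/=; lra.
  by rewrite opprB addrC subrK mulfK// gt_eqF.
have s4 : 0 < s * (d / 4) by rewrite mulr_gt0.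
have s4d : s * (d / 4) < d by nra.
have h1 : q (d / 4) e * (1 - A) <= q (s * (d / 4)) z.
  have := hs e z (d / 4) (s * (d / 4)) e1 z1; rewrite dotC ze lexx => /(_ isT d4).
  by rewrite subr0 mulr1; apply; [lra|rewrite s4 lexx].
have qz : 0 <= q (s * (d / 4)) z by apply: q_ge0 => //; rewrite s4.
have h2 : q (s * (d / 4)) z * (1 - A) <= q t b.
  apply: (@le_trans _ _ (q (s * (d / 4)) z * (1 - A * (1 - dot z b)))).
    by rewrite ler_wpM2l//; nra.
  apply: hs => //; first by nra.
  by rewrite t0 ltW.
have -> : 1 - u x = q t b * t by rewrite /q -xE divfK// gt_eqF.
rewrite ler_wpM2r ?(ltW t0)//; apply: le_trans h2.
apply: (@le_trans _ _ (d^-1 * (1 - A) * (1 - A))); last first.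
  by rewrite ler_wpM2r ?subr_ge0// -qe.
have dA : d^-1 * A <= eps / 2.
  rewrite -(ler_pM2l d0) mulrA mulfV ?gt_eqF// mul1r.
  by apply: le_trans A2 _; rewrite mulrA (mulrC d).
have di : 0 < d^-1 by rewrite invr_gt0.
by move: dA di A0; move: (d^-1) => di *; nra.
Qed.

End Blowup.

(** * Gradients and critical points *)

Section GradientCalculus.
Context {R : realType} {n : nat}.
Implicit Types (f g : 'rV[R]_n -> R) (x z : 'rV[R]_n) (V W : 'rV[R]_n -> 'rV[R]_n).

(** Only partial derivatives are recorded, with no total differential; critical point arguments use
    no more. *)
Definition has_grad f x (v : 'rV[R]_n) :=
  forall j, is_derive x (evec R j) f (v ord0 j).

(** A critical point equation is a vanishing combination of three vectors; pairing it with a chosen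
    [D] extracts a scalar equation. *)
Lemma dot_lin3 (a b c : R) (A B C D : 'rV[R]_n) : a *: A + b *: B + c *: C = 0 ->
  a * dot D A + b * dot D B + c * dot D C = 0.
Proof.
move=> /(congr1 (dot D)); rewrite !dotDr !dotZr => ->.
exact: dot0r.
Qed.

Lemma has_grad_add f g x v w : has_grad f x v -> has_grad g x w ->
  has_grad (fun y => f y + g y) x (v + w).
Proof. by move=> hf hg j; rewrite mxE; exact: is_derive_addf. Qed.

Lemma has_grad_opp f x v : has_grad f x v -> has_grad (fun y => - f y) x (- v).
Proof. by move=> hf j; rewrite mxE; exact: is_derive_oppf. Qed.

Lemma has_grad_sub f g x v w : has_grad f x v -> has_grad g x w ->
  has_grad (fun y => f y - g y) x (v - w).
Proof. by move=> hf hg j; rewrite !mxE; exact: is_derive_subf. Qed.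

Lemma has_grad_mul f g x v w : has_grad f x v -> has_grad g x w ->
  has_grad (fun y => f y * g y) x (g x *: v + f x *: w).
Proof.
by move=> hf hg j; rewrite !mxE (mulrC (g x)); exact: is_derive_mulf.
Qed.

Lemma has_grad_cst (c : R) x : has_grad (fun=> c) x 0.
Proof. by move=> j; rewrite mxE; exact: is_derive_cstf. Qed.

Lemma has_grad_scale (c : R) f x v :
  has_grad f x v -> has_grad (fun y => c * f y) x (c *: v).
Proof. by move=> hf j; rewrite mxE; exact: is_derive_scalef. Qed.

Lemma has_grad_sqr f x v :
  has_grad f x v -> has_grad (fun y => f y ^+ 2) x ((2 * f x) *: v).
Proof. by move=> hf j; rewrite mxE; exact: is_derive_sqrf. Qed.

Lemma has_grad_dot z x : has_grad (fun y => dot (y - z) (y - z)) x (2 *: (x - z)).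
Proof. by move=> j; rewrite mxE -dot_evec; exact: is_derive_sqr_enorm. Qed.

Lemma has_grad_enorm z x : x <> z ->
  has_grad (fun y => enorm (y - z)) x ((enorm (x - z))^-1 *: (x - z)).
Proof.
by move=> xz j; rewrite mxE -dot_evec mulrC; exact: is_derive_enorm.
Qed.

Lemma has_grad_inv_enorm z x : x <> z ->
  has_grad (fun y => (enorm (y - z))^-1) x (- (enorm (x - z) ^- 3 *: (x - z))).
Proof.
by move=> xz j; rewrite 2!mxE -dot_evec mulrC; exact: is_derive_inv_enorm.
Qed.

Lemma has_grad_local_max f x v : (\forall y \near x, f y <= f x) ->
  has_grad f x v -> v = 0.
Proof.
by move=> h hf; apply/rowP => j; rewrite mxE; exact: local_max_derive (hf j).
Qed.

Lemma has_grad_local_min f x v : (\forall y \near x, f x <= f y) ->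
  has_grad f x v -> v = 0.
Proof.
by move=> h hf; apply/rowP => j; rewrite mxE; exact: local_min_derive (hf j).
Qed.

Definition cont_vec V x := forall j, {for x, continuous (fun y => V y ord0 j)}.

Lemma cont_vec_dot V W x : cont_vec V x -> cont_vec W x ->
  {for x, continuous (fun y => dot (V y) (W y))}.
Proof. by move=> hV hW; apply: cont_sumf => i; exact: cont_mulf. Qed.

Lemma cont_vec_sub z x : cont_vec (fun y => y - z) x.
Proof. by move=> j; exact: cont_coord. Qed.

End GradientCalculus.

(** * Speed of a classical infinity-harmonic function *)

Section InfHarmonicC2.
Context {R : realType} {n : nat}.
Variables (U : set 'rV[R]_n) (u : 'rV[R]_n -> R).
Hypotheses (oU : open U) (u2 : C2_on U u).
Hypothesis u_inf : forall x, U x -> inf_laplacian u x = 0.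
Implicit Types x y z w : 'rV[R]_n.

Let h i j := partial j (partial i u).

Definition egrad x : 'rV[R]_n := \row_i partial i u x.
Definition speed x : R := dot (egrad x) (egrad x).
(** In matrix form, [2 D^2u Du]. *)
Definition grad_speed x : 'rV[R]_n := \row_j \sum_(i < n) 2 * partial i u x * h i j x.
(** The gradient of [Du . (x - z)], that is [D^2u (x - z) + Du]. *)
Definition grad_along z x : 'rV[R]_n :=
  (\row_j \sum_(i < n) h i j x * (x - z) ord0 i) + egrad x.

Let speedE : speed = fun x => \sum_(i < n) partial i u x ^+ 2.
Proof. by apply/funext => x; apply: eq_bigr => i _; rewrite !mxE expr2. Qed.

Lemma speed_ge0 x : 0 <= speed x.
Proof. exact: dot_ge0. Qed.

Lemma egrad_eq0 x : speed x = 0 -> egrad x = 0.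
Proof.
by move=> h0; apply/eqP; rewrite -enorm_eq0 enormE -/(speed x) h0 sqrtr0.
Qed.

Lemma has_egrad x : U x -> has_grad u x (egrad x).
Proof. by move=> Ux j; rewrite mxE; case: (C2_on_derive u2 Ux). Qed.

Lemma has_grad_speed x : U x -> has_grad speed x (grad_speed x).
Proof.
move=> Ux j; rewrite mxE speedE; apply: is_derive_sumf => i.
by apply: is_derive_sqrf; case: (C2_on_derive u2 Ux) => _; apply.
Qed.

Lemma has_grad_along z x : U x ->
  has_grad (fun y => dot (egrad y) (y - z)) x (grad_along z x).
Proof.
move=> Ux j; apply: is_derive_eq.
  apply: is_derive_sumf => i; apply: is_derive_mulf (is_derive_coord z x _ i).
  rewrite (_ : (fun y => egrad y ord0 i) = partial i u); last first.
    by apply/funext => y; rewrite mxE.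
  by case: (C2_on_derive u2 Ux) => _; apply.
rewrite !mxE big_split/=; congr (_ + _).
rewrite (bigD1 j)//= big1 ?addr0 => [|i ij]; first by rewrite evecE eqxx mulr1 mxE.
by rewrite evecE eq_sym (negbTE ij) mulr0.
Qed.

Let sym x i j : U x -> h i j x = h j i x.
Proof.
rewrite /h => Ux; apply: (@partialC _ _ U) => //.
- by move=> k y Uy; case: (C2_on_derive u2 Uy) => /(_ k)[].
- by move=> k l y Uy; case: (C2_on_derive u2 Uy) => _ /(_ k l)[].
- by case: (C2_on_cont oU u2 Ux).
Qed.

(* This is the invariance of the speed under the gradient flow. *)
Lemma dot_egrad_grad_speed x : U x -> dot (egrad x) (grad_speed x) = 0.
Proof.
move=> Ux; transitivity (2 * inf_laplacian u x); last by rewrite u_inf// mulr0.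
rewrite /inf_laplacian exchange_big mulr_sumr; apply: eq_bigr => j _ /=.
by rewrite !mxE !mulr_sumr; apply: eq_bigr => i _; rewrite /h; ring.
Qed.

(** By symmetry of the Hessian, [Du . D^2u (x - z) = D^2u Du . (x - z)], which is half the pairing
    with [grad_speed]. *)
Lemma dot_egrad_grad_along z x : U x ->
  dot (egrad x) (grad_along z x) = speed x + 2^-1 * dot (grad_speed x) (x - z).
Proof.
move=> Ux; rewrite /grad_along [LHS]dotDr [RHS]addrC; congr (_ + _).
rewrite /dot mulr_sumr.
transitivity (\sum_(j < n) \sum_(i < n) partial j u x * (h i j x * (x - z) ord0 i)).
  by apply: eq_bigr => j _; rewrite !mxE mulr_sumr.
rewrite exchange_big; apply: eq_bigr => i _ /=.
rewrite [grad_speed x ord0 i]mxE mulrA mulr_sumr mulr_suml; apply: eq_bigr => j _.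
by rewrite (sym _ _ Ux); field.
Qed.

Lemma cont_vec_egrad x : U x -> cont_vec egrad x.
Proof.
move=> Ux j; rewrite (_ : (fun y => egrad y ord0 j) = partial j u).
  by case: (C2_on_cont oU u2 Ux).
by apply/funext => y; rewrite mxE.
Qed.

Lemma cont_u x : U x -> {for x, continuous u}.
Proof. by move=> Ux; case: (C2_on_cont oU u2 Ux). Qed.

Lemma cont_speed x : U x -> {for x, continuous speed}.
Proof. by move=> Ux; apply: cont_vec_dot; exact: cont_vec_egrad. Qed.

Lemma cont_along z x : U x -> {for x, continuous (fun y => dot (egrad y) (y - z))}.
Proof. by move=> Ux; apply: cont_vec_dot; [exact: cont_vec_egrad|exact: cont_vec_sub]. Qed.

Lemma cont_grad_along z x : U x -> cont_vec (grad_along z) x.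
Proof.
move=> Ux j.
rewrite (_ : (fun y => _) =
    fun y => \sum_(i < n) h i j y * (y - z) ord0 i + partial j u y); last first.
  by apply/funext => y; rewrite !mxE.
have [_ c1 c2] := C2_on_cont oU u2 Ux.
apply: cont_addf => //; apply: cont_sumf => i; apply: cont_mulf; last exact: cont_coord.
exact: c2.
Qed.

Lemma compact_annulus z (r1 r2 : R) :
  compact [set y : 'rV[R]_n | r1 <= enorm (y - z) <= r2].
Proof.
apply: bounded_closed_compact.
  by apply: (@enorm_bounded _ _ _ z r2) => y /andP[].
rewrite (_ : [set y | _] = (fun y => enorm (y - z)) @^-1` `[r1, r2]%classic).
  apply: closed_comp; [move=> ? _; exact: enormB_continuous|].
  exact: itv_closed.
by apply/funext => y; rewrite /= in_itv.
Qed.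

(* If the speed vanished at [w], the minimum over the annulus of
   [(speed + eta) |y - z|^4] would be attained inside, at a point where the flow is
   tangent to the sphere but bends outwards; adding a small multiple of the radial
   component [p . (y - z)] of the flow turns this second-order contradiction into a
   first-order one. *)
Lemma speed_annulus z w (r1 r2 a : R) : 0 < r1 -> 0 < a ->
  r1 < enorm (w - z) < r2 ->
  (forall y, r1 <= enorm (y - z) <= r2 -> U y) ->
  (forall y, enorm (y - z) = r1 -> a <= speed y) ->
  0 < speed w.
Proof.
move=> r10 a0 /andP[r1w wr2] AU ha; rewrite lt_neqAle speed_ge0 andbT.
apply/eqP => /esym w0.
pose A := [set y : 'rV[R]_n | r1 <= enorm (y - z) <= r2].
have cA : compact A by exact: compact_annulus.
have Aw : A w by rewrite /A/= !ltW.
pose sq y := dot (y - z) (y - z).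
have sqE y : sq y = enorm (y - z) ^+ 2 by rewrite sqr_enorm.
pose S y := dot (egrad y) (y - z).
have Sw : S w = 0 by rewrite /S egrad_eq0// dot0l.
have r20 : 0 < r2 by lra.
have r1w2 : r1 ^+ 2 < sq w by rewrite sqE ltr_pXn2r ?nnegrE ?enorm_ge0// ltW.
have wr22 : sq w < r2 ^+ 2 by rewrite sqE ltr_pXn2r ?nnegrE ?enorm_ge0// ltW.
have r1sq : 0 < r1 ^+ 2 by rewrite exprn_gt0.
have r2sq : 0 < r2 ^+ 2 by rewrite exprn_gt0.
set s1 := r1 ^+ 2 in r1w2 r1sq; set s2 := r2 ^+ 2 in wr22 r2sq.
have sqA y : A y -> s1 <= sq y.
  move=> /andP[h1 _]; rewrite sqE ler_pXn2r ?nnegrE ?enorm_ge0//.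
  exact: ltW.
(* With [eta * s2 ^+ 2 = a * s1 ^+ 2 / 2], the value at [w] lies below the values of
   [(speed + eta) * sq ^+ 2] on both boundary spheres. *)
pose eta := a * s1 ^+ 2 / (2 * s2 ^+ 2).
have s22 : 0 < s2 ^+ 2 by rewrite exprn_gt0.
have eta0 : 0 < eta by rewrite divr_gt0 ?mulr_gt0 ?exprn_gt0.
have etaE : eta * s2 ^+ 2 = a * s1 ^+ 2 / 2.
  by rewrite /eta; field; rewrite gt_eqF.
have [B1 B10 hB1] : exists2 M : R, 0 < M & forall y, A y -> `|S y| <= M.
  by apply: compact_norm_bound => // y /AU; exact: cont_along.
have [B2 B20 hB2] : exists2 M : R, 0 < M &
    forall y, A y -> `|dot (grad_along z y) (y - z)| <= M.
  apply: compact_norm_bound => // y /AU Uy; apply: cont_vec_dot.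
    exact: cont_grad_along.
  exact: cont_vec_sub.
pose Phi (k : R) y := (speed y + eta) * sq y ^+ 2 + k * S y.
(* The three bounds are the margin on the outer sphere, the margin on the inner sphere, and the
   margin in the final radial equation. *)
pose mu := Num.min (eta * (s2 ^+ 2 - sq w ^+ 2)) (Num.min (a * s1 ^+ 2 / 2) (4 * eta * s1 ^+ 2)).
have w22 : sq w ^+ 2 < s2 ^+ 2 by rewrite ltr_pXn2r ?nnegrE ?ltW//; lra.
have mu0 : 0 < mu.
  have s12 : 0 < s1 ^+ 2 by rewrite exprn_gt0.
  rewrite !lt_min; apply/and3P; split.
  - by apply: mulr_gt0 => //; rewrite subr_gt0.
  - by apply: divr_gt0 => //; exact: mulr_gt0.
  - by apply: mulr_gt0 => //; exact: mulr_gt0.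
have mu1 : mu <= eta * (s2 ^+ 2 - sq w ^+ 2) by rewrite ge_min lexx.
have mu2 : mu <= a * s1 ^+ 2 / 2 by rewrite !ge_min lexx orbT.
have mu3 : mu <= 4 * eta * s1 ^+ 2 by rewrite !ge_min lexx !orbT.
pose k0 := mu / (B1 + B2).
have k00 : 0 < k0 by rewrite divr_gt0// addr_gt0.
have k0E : k0 * B1 + k0 * B2 = mu by rewrite -mulrDr divfK// gt_eqF// addr_gt0.
have k0B1 : k0 * B1 < mu by rewrite -k0E ltrDl mulr_gt0.
have k0B2 : k0 * B2 < mu by rewrite -k0E ltrDr mulr_gt0.
have minP (k : R) : 0 <= k <= k0 -> exists y, [/\ A y, forall v, A v -> Phi k y <= Phi k v &
    sq y ^+ 2 *: grad_speed y + ((speed y + eta) * (4 * sq y)) *: (y - z)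
     + k *: grad_along z y = 0].
  move=> /andP[k_ge0 k_le].
  have [|||y [Ay ymin]] := @compact_min R n A (Phi k).
  - exact: cA.
  - by exists w.
  - move=> y /AU Uy; apply: cont_addf.
      apply: cont_mulf; first by apply: cont_addf; [exact: cont_speed|exact: cont_cstf].
      by apply: cont_sqrf; exact: cont_dot.
    by apply: cont_mulf; [exact: cont_cstf|exact: cont_along].
  exists y; split => //.
  have kS : k * `|S y| < mu.
    apply: le_lt_trans k0B1; apply: ler_pM => //; exact: hB1.
  have kS' : - (k * `|S y|) <= k * S y.
    by rewrite -mulrN ler_wpM2l// lerNl -normrN ler_norm.
  have Phiw : Phi k y <= eta * sq w ^+ 2.
    by apply: le_trans (ymin w Aw) _; rewrite /Phi w0 Sw mulr0 addr0 add0r.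
  have yint : r1 < enorm (y - z) < r2.
    have /andP[y1 y2] := Ay; apply/andP; split; rewrite lt_neqAle ?y1 ?y2 andbT;
      apply/eqP => yE; move: Phiw; apply/negP; rewrite -ltNge /Phi.
      have sy : sq y = s1 by rewrite sqE -yE.
      have ay := ha y (esym yE); rewrite sy.
      have : a * s1 ^+ 2 <= (speed y + eta) * s1 ^+ 2.
        by rewrite ler_wpM2r ?sqr_ge0//; lra.
      have : eta * sq w ^+ 2 < eta * s2 ^+ 2 by rewrite ltr_pM2l.
      by rewrite etaE; lra.
    have sy : sq y = s2 by rewrite sqE yE.
    rewrite sy; have : eta * s2 ^+ 2 <= (speed y + eta) * s2 ^+ 2.
      by rewrite ler_wpM2r ?sqr_ge0// lerDr speed_ge0.
    by move: mu1; rewrite mulrBr; lra.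
  have Uy : U y by exact: AU.
  have gradPhi : has_grad (Phi k) y ((sq y ^+ 2) *: (grad_speed y + 0) +
      (speed y + eta) *: ((2 * sq y) *: (2 *: (y - z))) + k *: grad_along z y).
    apply: has_grad_add; last by apply: has_grad_scale; exact: has_grad_along.
    apply: has_grad_mul.
      by apply: has_grad_add; [exact: has_grad_speed|exact: has_grad_cst].
    by apply: has_grad_sqr; exact: has_grad_dot.
  have /has_grad_local_min/(_ gradPhi) : \forall v \near y, Phi k y <= Phi k v.
    have oA : open ((fun v => enorm (v - z)) @^-1` `]r1, r2[%classic).
      by apply: open_comp; [move=> ? _; exact: enormB_continuous|exact: itv_open].
    have : \forall v \near y, r1 < enorm (v - z) < r2.
      by apply: open_nbhs_nbhs; split; first by move: oA; rewrite set_itvE.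
    by apply: filterS => v /andP[v1 v2]; apply: ymin; rewrite /A/= !ltW.
  rewrite addr0 !scalerA.
  have -> : (speed y + eta) * (2 * sq y) * 2 = (speed y + eta) * (4 * sq y) by ring.
  by [].
have [|y0 [Ay0 min0 crit0]] := minP 0; first by rewrite lexx ltW.
have [|y1 [Ay1 min1 crit1]] := minP k0; first by rewrite lexx ltW.
have S0 : S y0 = 0.
  have := dot_lin3 (egrad y0) crit0.
  rewrite mul0r addr0 dot_egrad_grad_speed ?mulr0 ?add0r; last exact: AU.
  move=> /eqP; rewrite mulf_eq0 => /orP[|/eqP//].
  rewrite gt_eqF// mulr_gt0//; first by rewrite ltr_pwDr// speed_ge0.
  by rewrite mulr_gt0//; have := sqA _ Ay0; lra.
(* The minimality of [y0] for [Phi 0] and of [y1] for [Phi k0] are added, using [S y0 = 0]. *)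
have S1 : S y1 <= 0.
  have := min1 y0 Ay0; have := min0 y1 Ay1; rewrite /Phi S0 !mul0r mulr0 !addr0.
  move=> h1 h2; have : k0 * S y1 <= 0 by lra.
  by rewrite pmulr_rle0.
have := dot_lin3 (egrad y1) crit1; have := dot_lin3 (y1 - z) crit1.
rewrite dot_egrad_grad_speed ?dot_egrad_grad_along; try exact: AU.
rewrite mulr0 add0r -/(sq y1) -/(S y1) !(dotC (y1 - z)).
have := hB2 y1 Ay1; have := sqA _ Ay1; have := speed_ge0 y1.
set X := dot (grad_speed y1) _; set Y := dot (grad_along z y1) _.
move: (sq y1) (speed y1) (S y1) S1 => q f s S1 f0 qs1 Y2 E2 E1.
have q0 : 0 < q by lra.
have kY : `|k0 * Y| < 4 * eta * s1 ^+ 2.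
  rewrite normrM gtr0_norm//; apply: lt_le_trans mu3; apply: le_lt_trans k0B2.
  by rewrite ler_wpM2l// ltW.
have qq : s1 ^+ 2 <= q ^+ 2 by rewrite ler_pXn2r ?nnegrE ?(ltW q0)// ltW.
have q20 : 0 < q ^+ 2 by rewrite exprn_gt0.
have kY' : - (k0 * Y) < 4 * eta * q ^+ 2.
  have : - (k0 * Y) <= `|k0 * Y| by rewrite -normrN ler_norm.
  have : 4 * eta * s1 ^+ 2 <= 4 * eta * q ^+ 2 by rewrite ler_wpM2l// mulr_ge0// ltW.
  by lra.
(* This is the derivative of [S] along the flow at [y1]. The radial equation makes it negative,
   whereas the equation paired with [Du], with [S y1 <= 0], makes it nonnegative. *)
have neg : f + 2^-1 * X < 0.
  rewrite -(pmulr_rlt0 _ q20); have : 0 <= f * q ^+ 2 by rewrite mulr_ge0 ?sqr_ge0.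
  by move: E2 kY'; rewrite expr2; lra.
have : k0 * (f + 2^-1 * X) < 0 by rewrite pmulr_rlt0.
have : (f + eta) * (4 * q) * s <= 0.
  by rewrite pmulr_rle0// mulr_gt0 ?mulr_gt0//; lra.
by lra.
Qed.

(** Continuity gives a positive lower bound on a small sphere about [z], and [speed_annulus] carries
    positivity from there to the rest of the ball. *)
Lemma speed_ball z w (r : R) : (forall y, enorm (y - z) <= r -> U y) ->
  enorm (w - z) < r -> 0 < speed z -> 0 < speed w.
Proof.
move=> BU wr z0; have r0 : 0 < r by apply: le_lt_trans wr; exact: enorm_ge0.
have Uz : U z by apply: BU; rewrite subrr enorm0 ltW.
have : \forall y \near z, speed z / 2 < speed y.
  have lt2 : speed z / 2 < speed z by rewrite ltr_pdivrMr// ltr_pMr// ltr1n.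
  exact: cvgr_gt (cont_speed Uz) _ lt2.
move=> /nbhs_eballP[e e0 he].
have [we|we] := ltP (enorm (w - z)) e.
  by apply: lt_trans (he w we); rewrite divr_gt0.
apply: (@speed_annulus z w (e / 2) r (speed z / 2)) => //.
- by rewrite divr_gt0.
- by rewrite divr_gt0.
- by rewrite wr andbT; lra.
- by move=> y /andP[_]; exact: BU.
- by move=> y yE; apply: ltW; apply: he; rewrite /eball/= yE; lra.
Qed.

(** At a first zero on the segment, a ball centred at a slightly earlier point contains that zero
    and contradicts [speed_ball]. *)
Lemma speed_segment x y : (forall s : R, 0 <= s <= 1 -> U (x + s *: (y - x))) ->
  0 < speed x -> 0 < speed y.
Proof.
move=> seg fx; pose l (s : R) := x + s *: (y - x).
have lc s : {for s, continuous l} by exact: shift_line_continuous.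
apply: contrapT => fy.
pose S := `[(0 : R), 1]%classic `&` (speed \o l) @^-1` [set t | t <= 0].
have cfl s : 0 <= s <= 1 -> {for s, continuous (speed \o l)}.
  by move=> s01; apply: continuous_comp; [exact: lc|apply: cont_speed; exact: seg].
have cS : compact S.
  have : {within `[(0 : R), 1]%classic, continuous (speed \o l)}.
    by apply: continuous_in_subspaceT => s /set_mem/=; rewrite in_itv/=; exact: cfl.
  move=> /continuous_closedP/(_ _ (@closed_le R 0))/closed_subspaceP[V cV VS].
  rewrite /S setIC -VS setIC; apply: compact_closedI => //; exact: segment_compact.
have S0 : S !=set0.
  exists 1; split; rewrite /= ?in_itv/= ?ler01 ?lexx//.
  by rewrite /l scale1r addrC subrK leNgt; apply/negP.
have [|s /set_mem[]] := @compact_EVT_min _ R (fun s : R => s) S S0 cS.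
  by apply: continuous_subspaceT => s; exact: cvg_id.
rewrite /= in_itv/= => /andP[s0 s1] fs smin.
have {}s0 : 0 < s.
  rewrite lt_neqAle s0 andbT; apply/eqP => s0'; move: fs.
  by rewrite /l -s0' scale0r addr0 leNgt fx.
have /nbhs_eballP[r r0 hr] : nbhs (l s) U.
  by apply: open_nbhs_nbhs; split => //; apply: seg; rewrite (ltW s0).
pose c := 1 + enorm (y - x).
have c0 : 0 < c by rewrite ltr_pwDl// enorm_ge0.
(* The centre is within [r / 4] of the first zero, and clipped so as to stay on the segment. *)
pose t := Num.max 0 (s - r / (4 * c)).
have ts : t < s by rewrite gt_max s0/= ltrBlDr ltrDl divr_gt0// mulr_gt0.
have t0 : 0 <= t by rewrite le_max lexx.
have ft : 0 < speed (l t).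
  rewrite ltNge; apply/negP => ft; have : s <= t.
    by apply: smin; apply: mem_set; split => //=; rewrite in_itv/=; lra.
  by rewrite leNgt ts.
have dist : enorm (l s - l t) < r / 2.
  have -> : l s - l t = (s - t) *: (y - x) by rewrite opprD addrACA subrr add0r scalerBl.
  rewrite enormZ ger0_norm ?subr_ge0 ?(ltW ts)//.
  have : s - t <= r / (4 * c).
    have : s - r / (4 * c) <= t by rewrite le_max lexx orbT.
    by lra.
  have -> : r / (4 * c) = r / 4 / c by rewrite invfM mulrA.
  rewrite ler_pdivlMr// /c mulrDr mulr1 => st.
  have : 0 <= s - t by lra.
  by lra.
have : 0 < speed (l s).
  apply: (@speed_ball (l t) (l s) (r / 2)) => // v vr; apply: hr; rewrite /eball/=.
  apply: le_lt_trans (ler_enorm_trans v (l t) (l s)) _.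
  by move: dist; rewrite (enormB (l s)); lra.
by rewrite ltNge fs.
Qed.

End InfHarmonicC2.

(** * Asymptotic slope of the potential at its pole *)

Section PotentialBlowup.
Context {R : realType} {n : nat}.
Variables (O : set 'rV[R]_n) (x0 ys : 'rV[R]_n) (u : 'rV[R]_n -> R).
Hypotheses (n2 : (2 <= n)%N) (oO : open O) (bO : bounded_set O) (Ox0 : O x0).
Hypothesis hu : inf_harmonic_potential O x0 u.
Hypotheses (bys : (closure O `\` O) ys)
  (ysmin : forall z, (closure O `\` O) z -> enorm (ys - x0) <= enorm (z - x0)).
Let d := enorm (ys - x0).

Lemma potential_blowup (eps : R) : 0 < eps -> exists2 r0 : R, 0 < r0 &
  forall x, 0 < enorm (x - x0) < r0 -> (d^-1 - eps) * enorm (x - x0) <= 1 - u x.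
Proof.
have d0 : 0 < d := inradius_gt0 Ox0 bys.
apply: (@blowup_cone _ _ x0 u d n2 d0 _ _ (d^-1 *: (ys - x0))).
- by move=> y yd; apply: (@potential_le1 _ _ O x0) => //; apply: inball_sub yd.
- by move=> x y; apply: (@potential_ball_slope _ _ O x0 u).
- by apply: enorm_normalize; rewrite -enorm_gt0.
move=> r /andP[r0 rd]; rewrite scalerA mulrC.
apply: (@potential_on_segment _ _ O) => //.
by rewrite mulr_ge0 ?invr_ge0 ?ltW//= mulrC ltr_pdivrMr// mul1r.
Qed.

End PotentialBlowup.

(** * A twice differentiable potential forces a ball *)

Section C2Rigidity.
Context {R : realType} {n : nat}.
Variables (O : set 'rV[R]_n) (x0 ys : 'rV[R]_n) (u : 'rV[R]_n -> R).
Hypotheses (n2 : (2 <= n)%N) (oO : open O) (bO : bounded_set O) (Ox0 : O x0).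
Hypothesis convO : Defs.convex_set O.
Hypothesis hu : inf_harmonic_potential O x0 u.
Hypotheses (bys : (closure O `\` O) ys)
  (ysmin : forall z, (closure O `\` O) z -> enorm (ys - x0) <= enorm (z - x0)).
Hypothesis u2 : C2_on (O `\ x0) u.
Implicit Types x y z : 'rV[R]_n.

Let d := enorm (ys - x0).
Let Om := O `\ x0.
Let f := speed u.
Let P := egrad u.

Let oOm : open Om. Proof. by apply: open_punctured. Qed.
Let d0 : 0 < d. Proof. exact (inradius_gt0 Ox0 bys). Qed.
Let cu : {within closure O, continuous u}. Proof. by case: hu. Qed.
Let u_bdry y : closure O y -> ~ O y -> u y = 0.
Proof. by case: hu => _ _ h _ cy nO; apply: h. Qed.
Let u_x0 : u x0 = 1. Proof. by case: hu. Qed.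
Let u_le1 y : O y -> u y <= 1. Proof. by apply: (@potential_le1 _ _ O x0). Qed.
Let u_ge0 y : O y -> 0 <= u y. Proof. by apply: (@potential_ge0 _ _ O x0). Qed.
Let ball_sub y : enorm (y - x0) < d -> O y. Proof. by apply: (@inball_sub _ _ O x0). Qed.
Let u_cone y : O y -> 1 - d^-1 * enorm (y - x0) <= u y.
Proof. by apply: (@potential_ge_cone _ _ O x0). Qed.
Let u_lip x y : O x -> O y -> u y <= u x + d^-1 * enorm (y - x).
Proof. by apply: (@potential_lipschitz _ _ O x0). Qed.
Let u_seg (s : R) : 0 <= s < 1 -> u (x0 + s *: (ys - x0)) = 1 - s.
Proof. by apply: (@potential_on_segment _ _ O). Qed.

(** Being of class C^2, [u] is its own test function from above and from below. *)
Let u_inf x : Om x -> inf_laplacian u x = 0.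
Proof.
move=> Omx; case: hu => _ [_ [hsub hsuper]] _ _.
have W : exists W : set 'rV[R]_n, [/\ open W, W x & C2_on W u] by exists Om.
apply/eqP; rewrite eq_le; apply/andP; split.
  by apply: hsuper => //; near=> y; rewrite !subrr.
by apply: hsub => //; near=> y; rewrite !subrr.
Unshelve. all: by end_near. Qed.

Let increment x (e : R) : Om x -> 0 < e -> exists2 r : R, 0 < r &
  forall w, enorm w < r ->
    `|u (x + w) - u x - dot w (P x)| <= e * \sum_(i < n) `|w ord0 i|.
Proof.
move=> Omx e0.
have [|||r r0 hr] := @C1_increment _ _ Om u x e oOm Omx.
- by move=> i y Oy; have [/(_ i)[]] := C2_on_derive u2 Oy.
- by move=> i; have [_ + _] := C2_on_cont oOm u2 Omx; apply.
- exact: e0.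
exists r => // w /hr; congr (`|_ - _| <= _).
by apply: eq_bigr => i _; rewrite mxE.
Qed.

Let small_w (v : 'rV[R]_n) (r : R) : 0 < r -> exists2 t : R, 0 < t & enorm (t *: v) < r.
Proof.
move=> r0; have c0 : 0 < 1 + enorm v by rewrite ltr_pwDl// enorm_ge0.
exists (r / (1 + enorm v)); first by rewrite divr_gt0.
rewrite enormZ ger0_norm ?divr_ge0 ?ltW// mulrAC ltr_pdivrMr//.
by rewrite ltr_pM2l// ltrDr.
Qed.

Let sum_normZ (t : R) (v : 'rV[R]_n) : 0 < t ->
  \sum_(i < n) `|(t *: v) ord0 i| = t * \sum_(i < n) `|v ord0 i|.
Proof.
move=> t0; rewrite mulr_sumr; apply: eq_bigr => i _.
by rewrite mxE normrM gtr0_norm.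
Qed.

(** A small step [t] along [P x] raises [u] by about [t |P x|^2], while the Lipschitz bound allows
    [t |P x| / d]. *)
Let P_le x : Om x -> enorm (P x) <= d^-1.
Proof.
move=> Omx; have [p0|p0] := eqVneq (enorm (P x)) 0; first by rewrite p0 invr_ge0 ltW.
have {}p0 : 0 < enorm (P x) by rewrite lt_def p0 enorm_ge0.
set M := \sum_(i < n) `|P x ord0 i|.
have M0 : 0 <= M by rewrite sumr_ge0.
suff H : enorm (P x) * enorm (P x) <= d^-1 * enorm (P x) by rewrite ler_pM2r in H.
apply/ler_addgt0Pr => e e0; pose e' := e / (1 + M).
have M1 : 0 < 1 + M by rewrite ltr_pwDl.
have e'0 : 0 < e' by rewrite divr_gt0.
have e'M : e' * M <= e.
  by rewrite /e' mulrAC ler_pdivrMr// ler_pM2l// lerDr.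
have [r r0 hr] := increment Omx e'0.
have /nbhs_eballP[r' r'0 hr'] : nbhs x Om by exact: open_nbhs_nbhs.
have rr : 0 < Num.min r r' by rewrite lt_min r0.
have [t t0] := small_w (P x) rr; rewrite lt_min => /andP[tr tr'].
have := hr _ tr; rewrite sum_normZ// -/M dotZl -sqr_enorm => hx.
have [Oy _] : Om (x + t *: P x) by apply: hr'; rewrite /eball/= addrAC subrr add0r.
have := u_lip (proj1 Omx) Oy.
rewrite addrAC subrr add0r enormZ gtr0_norm// => hl.
rewrite -(ler_pM2l t0); move: hx; rewrite ler_norml => /andP[hx _].
have : t * (e' * M) <= t * e by rewrite ler_pM2l.
by move: hx hl; rewrite expr2; lra.
Qed.

Let f_le x : Om x -> f x <= d^-1 ^+ 2.
Proof.
by move=> /P_le; rewrite /f/speed -sqr_enorm ler_pXn2r ?nnegrE ?enorm_ge0// invr_ge0 ltW.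
Qed.

Let dot_seg (s : R) : 0 < s < 1 -> dot (ys - x0) (P (x0 + s *: (ys - x0))) = -1.
Proof.
move=> /andP[s0 s1]; set v := ys - x0; set x := x0 + s *: v.
have Omx : Om x.
  split; first by apply: ball_sub; rewrite addrAC subrr add0r enormZ gtr0_norm// gtr_pMl.
  move=> /eqP; rewrite -subr_eq0 addrAC subrr add0r -enorm_eq0 enormZ gtr0_norm//.
  by rewrite mulf_eq0 !gt_eqF.
set M := \sum_(i < n) `|v ord0 i|.
have M0 : 0 <= M by rewrite sumr_ge0.
have M1 : 0 < 1 + M by rewrite ltr_pwDl.
apply/eqP; rewrite -subr_eq0 -normr_le0; apply/ler_addgt0Pr => e e0; rewrite add0r.
pose e' := e / (1 + M).
have e'0 : 0 < e' by rewrite divr_gt0.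
have e'M : e' * M <= e.
  by rewrite /e' mulrAC ler_pdivrMr// ler_pM2l// lerDr.
have [r r0 hr] := increment Omx e'0.
have s10 : 0 < (1 - s) * d by rewrite mulr_gt0// subr_gt0.
have rr : 0 < Num.min r ((1 - s) * d) by rewrite lt_min r0.
have [t t0] := small_w v rr; rewrite lt_min => /andP[tr].
rewrite enormZ gtr0_norm// ltr_pM2r// => ts.
have := hr _ tr; rewrite sum_normZ// -/M dotZl.
have -> : x + t *: v = x0 + (s + t) *: v by rewrite scalerDl addrA.
rewrite u_seg; last by rewrite addr_ge0 ?ltW//=; lra.
rewrite u_seg; last by rewrite ltW.
have -> : 1 - (s + t) - (1 - s) - t * dot v (P x) = - (t * (dot v (P x) - -1)) by ring.
rewrite normrN normrM gtr0_norm// mulrCA ler_pM2l// => h.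
by rewrite (le_trans h).
Qed.

(** Positivity starts at the midpoint [a] towards [ys] and travels along two segments [a b] and
    [b x]; the perpendicular detour through [b] avoids the pole. *)
Let f_gt0 x : Om x -> 0 < f x.
Proof.
move=> [Ox xx0]; have [e eE] : exists e, e = d^-1 *: (ys - x0) by eexists.
have e1 : enorm e = 1 by rewrite eE; apply: enorm_normalize; rewrite -enorm_gt0.
have [z [z1 ze zx]] := exists_perp e (x - x0) n2.
pose a := x0 + (d / 2) *: e; pose b := x0 + (d / 2) *: z.
have d2 : 0 < d / 2 by rewrite divr_gt0.
have Oa v : enorm v = 1 -> O (x0 + (d / 2) *: v).
  move=> v1; apply: ball_sub; rewrite addrAC subrr add0r enormZ v1 mulr1 gtr0_norm//.
  by move: d0; lra.
have seg y1 y2 : O y1 -> O y2 ->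
    (forall s : R, 0 <= s <= 1 -> y1 + s *: (y2 - y1) <> x0) ->
    0 < f y1 -> 0 < f y2.
  move=> O1 O2 h; apply: (speed_segment oOm u2 u_inf) => s s01; split; last exact: h.
  have -> : y1 + s *: (y2 - y1) = (1 - s) *: y1 + s *: y2.
    by apply/rowP => j; rewrite !mxE; ring.
  exact: convO.
have fa : 0 < f a.
  have aE : a = x0 + 2^-1 *: (ys - x0).
    by rewrite /a eE scalerA mulrAC mulfV ?gt_eqF// mul1r.
  rewrite lt_neqAle speed_ge0 andbT; apply/eqP => /esym/egrad_eq0 Pa.
  have := @dot_seg 2^-1; rewrite -aE /P Pa dot0r.
  have h01 : 0 < (2^-1 : R) < 1 by lra.
  by move=> /(_ h01) /eqP; rewrite eq_sym oppr_eq0 oner_eq0.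
have fb : 0 < f b.
  apply: (seg a b) => //; [exact: Oa|exact: Oa|] => s /andP[s0 s1] E.
  (* Relative to the pole, every point of this segment has product [d / 2] with [e + z], so none is
     the pole. *)
  have : dot (a + s *: (b - a) - x0) (e + z) = 0.
    by rewrite E subrr dot0l.
  have -> : a + s *: (b - a) - x0 = (d / 2) *: ((1 - s) *: e + s *: z).
    by apply/rowP => j; rewrite !mxE; ring.
  rewrite !dotE -!sqr_enorm e1 z1 (dotC e z) ze; move: d2; lra.
apply: (seg b x) => //; first exact: Oa.
move=> s /andP[s0 s1] E.
(* The product with [z] can vanish only at [s = 1], where the point is [x], different from the
   pole. *)
have : dot z (b + s *: (x - b) - x0) = 0.
  by rewrite E subrr dot0r.
have -> : b + s *: (x - b) - x0 = (1 - s) *: ((d / 2) *: z) + s *: (x - x0).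
  by apply/rowP => j; rewrite !mxE; ring.
rewrite dotDr !dotZr -sqr_enorm z1 expr1n mulr1 => h.
have s1' : s = 1.
  apply/eqP; rewrite eq_le s1/= leNgt; apply/negP => s1'.
  have : 0 < (1 - s) * (d / 2) by rewrite mulr_gt0// subr_gt0.
  have : 0 <= s * dot z (x - x0) by rewrite mulr_ge0.
  by lra.
by apply: xx0; rewrite -E s1' scale1r addrC subrK.
Qed.

Let cP x : Om x -> cont_vec P x. Proof. by move=> Omx; exact: (cont_vec_egrad oOm u2). Qed.
Let cf x : Om x -> {for x, continuous f}. Proof. by move=> Omx; exact: (cont_speed oOm u2). Qed.
Let cuO x : Om x -> {for x, continuous u}. Proof. by move=> Omx; exact: (cont_u oOm u2). Qed.
Let hP x : Om x -> has_grad u x (P x). Proof. by move=> Omx; exact: (has_egrad u2). Qed.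
Let DF := grad_speed u.
Let hf x : Om x -> has_grad f x (DF x). Proof. by move=> Omx; exact: (has_grad_speed u2). Qed.
Let PDF x : Om x -> dot (P x) (DF x) = 0.
Proof. by move=> Omx; exact: (dot_egrad_grad_speed u_inf). Qed.

Let u_lt1 x : Om x -> u x < 1.
Proof.
move=> Omx; rewrite lt_neqAle u_le1 ?andbT; last by case: Omx.
apply/eqP => ux; have : \forall y \near x, u y <= u x.
  have : \forall y \near x, Om y by exact: open_nbhs_nbhs.
  by apply: filterS => y [Oy _]; rewrite ux u_le1.
move=> /has_grad_local_max/(_ (hP Omx)) Px; have := f_gt0 Omx.
by rewrite /f/speed -/P Px dot0l ltxx.
Qed.

Let region_Om x (t t' : R) : closure O x -> 0 < t -> t' < 1 -> t <= u x <= t' -> Om x.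
Proof.
move=> cx t0 t'1 /andP[h1 h2]; split; last by move=> E; move: h2; rewrite E u_x0; lra.
by apply: contrapT => nO; move: h1; rewrite u_bdry//; lra.
Qed.

(** Replaces following a flow line: a maximum over a slab of levels lies on one of the two extreme
    levels or is a critical point. *)
Let region_max (H : 'rV[R]_n -> R) VH x1 (t t' : R) :
  (forall x, Om x -> {for x, continuous H}) ->
  (forall x, Om x -> has_grad H x (VH x)) ->
  0 < t -> t' < 1 -> Om x1 -> t <= u x1 <= t' ->
  exists z, [/\ Om z, t <= u z <= t', H x1 <= H z &
    [\/ u z = t, u z = t' | VH z = 0]].
Proof.
move=> cH hH t0 t'1 Om1 ht.
pose A := closure O `&` u @^-1` `[t, t']%classic.
have AE x : A x -> closure O x /\ t <= u x <= t' by move=> [cx]; rewrite /= in_itv.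
have AOm x : A x -> Om x by move=> /AE[cx hx]; exact: region_Om hx.
have [|||z [Az zmax]] := @compact_max _ _ A H.
- by apply: within_closed_compact => //; [exact: closure_compact|exact: itv_closed].
- by exists x1; split; [apply: subset_closure; case: Om1|rewrite /= in_itv].
- by move=> x /AOm; exact: cH.
have Omz := AOm z Az; have [_ /andP[z1 z2]] := AE z Az.
exists z; split => //; first by rewrite z1.
  by apply: zmax; split; [apply: subset_closure; case: Om1|rewrite /= in_itv].
have [|/eqP tz] := eqVneq (u z) t; first by move=> ?; apply: Or31.
have [|/eqP tz'] := eqVneq (u z) t'; first by move=> ?; apply: Or32.
apply: Or33; apply: has_grad_local_max (hH z Omz).
have {}z1 : t < u z by rewrite lt_neqAle z1 andbT eq_sym; apply/eqP.
have {}z2 : u z < t' by rewrite lt_neqAle z2 andbT; apply/eqP.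
have n1 : \forall y \near z, t < u y by exact: cvgr_gt (cuO Omz) _ z1.
have n2' : \forall y \near z, u y < t' by exact: cvgr_lt (cuO Omz) _ z2.
have n3 : \forall y \near z, Om y by exact: open_nbhs_nbhs.
apply: filterS3 n1 n2' n3 => y y1 y2 [Oy _]; apply: zmax; split.
  exact: subset_closure.
by rewrite /= in_itv/= !ltW.
Qed.

(** Maximizes [c u - (f - f x1) ^+ 2]. A critical point paired with [P] would give [c f = 0], and
    the sign of [c] excludes the level on the far side of [x1], so the maximum is reached at level
    [t]. *)
Let transport x1 (t e : R) : Om x1 -> 0 < u x1 -> 0 < t < 1 -> 0 < e ->
  exists z, [/\ Om z, u z = t & (f z - f x1) ^+ 2 <= e].
Proof.
move=> Om1 u1 /andP[t0 t1] e0; set a := f x1.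
have main (c lo hi : R) : c != 0 -> 0 < lo -> hi < 1 -> lo <= u x1 <= hi ->
    exists z, [/\ Om z, lo <= u z <= hi, c * u x1 <= c * u z - (f z - a) ^+ 2 &
      u z = lo \/ u z = hi].
  move=> c0 lo0 hi1 hx.
  have [||z [Omz hz Hz crit]] := @region_max (fun y => c * u y - (f y - a) ^+ 2)
     (fun y => c *: P y - (2 * (f y - a)) *: (DF y - 0)) x1 lo hi _ _ lo0 hi1 Om1 hx.
  - move=> x Omx; apply: cont_subf.
      by apply: cont_mulf; [exact: cont_cstf|exact: cuO].
    by apply: cont_sqrf; apply: cont_subf; [exact: cf|exact: cont_cstf].
  - move=> x Omx; apply: has_grad_sub; first by apply: has_grad_scale; exact: hP.
    by apply: has_grad_sqr; apply: has_grad_sub; [exact: hf|exact: has_grad_cst].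
  exists z; split => //; first by move: Hz; rewrite subrr expr0n/= subr0.
  case: crit => [->|->|/(congr1 (dot (P z)))]; [by left|by right|].
  rewrite subr0 dotBr !dotZr PDF// mulr0 subr0 dot0r => /eqP.
  by rewrite mulf_eq0 (negbTE c0)/= gt_eqF// f_gt0.
have ux1 := u_lt1 Om1.
have [tx|tx|tx] := ltgtP t (u x1); last by exists x1; rewrite subrr expr0n/= ltW.
(* The upper level only has to lie strictly between [u x1] and 1. *)
- have [||||z [Omz _ Hz ez]] := main (- e) t ((1 + u x1) / 2).
  + by rewrite oppr_eq0 gt_eqF.
  + by [].
  + by lra.
  + by rewrite (ltW tx)/=; lra.
  have sq := sqr_ge0 (f z - a).
  exists z; split => //.
    by case: ez => // uz; move: Hz; rewrite uz; nra.
  case: ez => uz; move: Hz; rewrite uz; nra.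
- have [||||z [Omz _ Hz ez]] := main e (u x1 / 2) t.
  + by rewrite gt_eqF.
  + by lra.
  + by [].
  + by rewrite (ltW tx) andbT; lra.
  have sq := sqr_ge0 (f z - a).
  exists z; split => //.
    by case: ez => // uz; move: Hz; rewrite uz; nra.
  case: ez => uz; move: Hz; rewrite uz; nra.
Qed.

Let level_ex (t : R) : 0 < t < 1 -> exists2 x, Om x & u x = t.
Proof.
move=> /andP[t0 t1]; exists (x0 + (1 - t) *: (ys - x0)); last first.
  by rewrite u_seg; lra.
apply: (@region_Om _ t t) => //.
  apply: subset_closure; apply: ball_sub; rewrite addrAC subrr add0r enormZ ger0_norm; last by lra.
  by rewrite gtr_pMl//; lra.
by rewrite u_seg; lra.
Qed.

Let level_min (t : R) : 0 < t < 1 -> exists x, [/\ Om x, u x = t &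
  forall y, Om y -> u y = t -> f x <= f y].
Proof.
move=> t01; have /andP[t0 t1] := t01.
pose A := closure O `&` u @^-1` [set t].
have AOm x : A x -> Om x.
  by move=> [cx ux]; apply: (@region_Om _ t t) => //; rewrite ux lexx.
have [|||z [Az zmin]] := @compact_min _ _ A f.
- by apply: within_closed_compact => //; exact: closure_compact.
- by have [x [Ox _] ux] := level_ex t01; exists x; split => //; exact: subset_closure.
- by move=> x /AOm; exact: cf.
exists z; split; [exact: AOm|by case: Az|move=> y [Oy _] uy].
by apply: zmin; split => //; exact: subset_closure.
Qed.

(** Transporting points to and from level 1/2 shows that all levels have the same minimal speed. *)
Let min_speed : exists2 m : R, 0 < m &
  (forall x, Om x -> 0 < u x -> m <= f x) /\
  (forall t, 0 < t < 1 -> exists x, [/\ Om x, u x = t & f x = m]).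
Proof.
have half : 0 < (2^-1 : R) < 1 by lra.
have [x1 [Om1 u1 min1]] := level_min half.
have u10 : 0 < u x1 by rewrite u1; lra.
have le_f x : Om x -> 0 < u x -> f x1 <= f x.
  move=> Omx ux; rewrite leNgt; apply/negP => lt.
  (* The transported speed moves by at most half the gap, so it would still be below the minimum on
     that level. *)
  pose e := ((f x1 - f x) / 2) ^+ 2.
  have e0 : 0 < e by rewrite exprn_gt0// divr_gt0// subr_gt0.
  have [z [Omz uz]] := transport Omx ux half e0.
  by have := min1 z Omz uz; rewrite /e; nra.
exists (f x1); [exact: f_gt0|split => // t t01].
have [x [Omx ux minx]] := level_min t01; exists x; split => //.
have ux0 : 0 < u x by rewrite ux; case/andP: t01.
apply/eqP; rewrite eq_le le_f// andbT leNgt; apply/negP => lt.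
pose e := ((f x - f x1) / 2) ^+ 2.
have e0 : 0 < e by rewrite exprn_gt0// divr_gt0// subr_gt0.
have [z [Omz uz]] := transport Om1 u10 t01 e0.
by have := minx z Omz uz; rewrite /e; nra.
Qed.

(** By compactness, [u] has a maximum below 1 at distance at least [r] from the pole. *)
Let near_top (r : R) : 0 < r -> exists2 t, 0 < t < 1 &
  forall z, Om z -> t <= u z -> enorm (z - x0) < r.
Proof.
move=> r0; pose A := closure O `&` (fun z => enorm (z - x0)) @^-1` [set s | r <= s].
have cA : compact A.
  apply: compact_closedI; first exact: closure_compact.
  by apply: closed_comp; [move=> ? _; exact: enormB_continuous|exact: closed_ge].
have [A0|/set0P/negP/negPn/eqP A0] := pselect (A !=set0); last first.
  exists 2^-1; first by lra.
  move=> z [Oz _] _; rewrite ltNge; apply/negP => rz.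
  have : A z by split => //; exact: subset_closure.
  by rewrite A0.
have cuA : {within A, continuous u} by apply: continuous_subspaceW cu => z [].
have [c /set_mem Ac cmax] := compact_EVT_max A0 cA cuA.
have uc : u c < 1.
  have [Oc|nO] := pselect (O c); last by rewrite u_bdry//; case: Ac.
  apply: u_lt1; split => // E; case: Ac => _ /=; rewrite E subrr enorm0; lra.
exists (Num.max 2^-1 ((1 + u c) / 2)).
  by rewrite lt_max gt_max; lra.
move=> z [Oz _]; rewrite ge_max => /andP[_ h]; rewrite ltNge; apply/negP => rz.
have : u z <= u c by apply: cmax; apply: mem_set; split => //; exact: subset_closure.
by lra.
Qed.

Let G y := dot (P y) (y - x0) - u y.

(* The Legendre transform [p . x - u] is constant along straight flow lines, and the
   flow lines on which the speed is minimal are straight; its value at the pole is [-1]. *)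
Let legendre (m : R) x1 : 0 < m -> (forall x, Om x -> 0 < u x -> m <= f x) ->
  Om x1 -> 0 < u x1 -> f x1 = m -> G x1 = -1.
Proof.
move=> m0 minf Om1 ux1 fm; set g1 := G x1.
apply/eqP; rewrite -subr_eq0 -normr_le0 leNgt; apply/negP => gap.
(* Near the pole, [|G z - g1|], [|P z . (z - x0)|] and [1 - u z] will each be at most [h], so the
   gap [4 h] would be at most [3 h]. *)
pose h := `|g1 - -1| / 4.
have h0 : 0 < h by rewrite divr_gt0.
have hd : 0 < h * d by rewrite mulr_gt0.
have [t1 /andP[t10 t11] ht1] := near_top hd.
pose t := Num.max t1 (Num.max (1 - h) ((1 + u x1) / 2)).
have u1 := u_lt1 Om1.
have t_lt1 : t < 1 by rewrite !gt_max t11/=; lra.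
have tt1 : t1 <= t by rewrite le_max lexx.
have th : 1 - h <= t by rewrite !le_max lexx orbT.
have tu : (1 + u x1) / 2 <= t by rewrite !le_max lexx !orbT.
have ut : u x1 < t by lra.
pose e := h ^+ 2.
have e0 : 0 < e by rewrite exprn_gt0.
pose lo := u x1 / 2.
have lo0 : 0 < lo by rewrite divr_gt0.
pose DG y := grad_along u x0 y - P y.
have hG y : Om y -> has_grad G y (DG y).
  by move=> Omy; apply: has_grad_sub; [exact: (has_grad_along u2)|exact: hP].
have cG y : Om y -> {for y, continuous G}.
  move=> Omy; apply: cont_subf; last exact: cuO.
  exact: (cont_along oOm u2).
(* The two scalar critical point equations will force [Bf z = e * f z * K]; the bound [B] does not
   depend on [K]. *)
pose Bf y := (G y - g1) *
  (e * dot (P y) (y - x0) - 2 * (G y - g1) * dot (DG y) (y - x0)).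
pose A := closure O `&` u @^-1` `[lo, t]%classic.
have AOm y : A y -> Om y by move=> [cy]; rewrite /= in_itv/=; exact: region_Om.
have [B B0 hB] : exists2 B : R, 0 < B & forall y, A y -> `|Bf y| <= B.
  apply: compact_norm_bound.
    by apply: within_closed_compact => //; [exact: closure_compact|exact: itv_closed].
  move=> y /AOm Omy.
  have cG1 : {for y, continuous (fun v => G v - g1)}.
    by apply: cont_subf; [exact: cG|exact: cont_cstf].
  apply: cont_mulf => //; apply: cont_subf.
    apply: cont_mulf; first exact: cont_cstf.
    by apply: cont_vec_dot; [exact: cP|exact: cont_vec_sub].
  apply: cont_mulf; first by apply: cont_mulf; [exact: cont_cstf|].
  apply: cont_vec_dot; last exact: cont_vec_sub.
  move=> j; rewrite (_ : (fun v => _) =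
      fun v => grad_along u x0 v ord0 j - P v ord0 j); last first.
    by apply/funext => v; rewrite !mxE.
  by apply: cont_subf; [exact: (cont_grad_along oOm u2)|exact: cP].
(* Makes [e * m * K] exceed [B], which rules out a critical point. *)
pose K := (B + 1) / (e * m).
have em : 0 < e * m by rewrite mulr_gt0.
have K0 : 0 < K by rewrite divr_gt0// addr_gt0.
have emK : e * m * K = B + 1 by rewrite mulrC divfK// gt_eqF.
have hx1 : lo <= u x1 <= t by rewrite (ltW ut) andbT /lo; lra.
(* Both penalties vanish at [x1]. The term [e * u] excludes the lower level, and [e = h ^+ 2] gives
   [|G z - g1| <= h] on the upper one. *)
have [||z [Omz /andP[z1 z2] Hz crit]] := @region_max
    (fun y => e * u y - K * (f y - m) - (G y - g1) ^+ 2)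
    (fun y => e *: P y - K *: (DF y - 0) - (2 * (G y - g1)) *: (DG y - 0))
    x1 lo t _ _ lo0 t_lt1 Om1 hx1.
- move=> y Omy; apply: cont_subf.
    apply: cont_subf; first by apply: cont_mulf; [exact: cont_cstf|exact: cuO].
    apply: cont_mulf; first exact: cont_cstf.
    by apply: cont_subf; [exact: cf|exact: cont_cstf].
  by apply: cont_sqrf; apply: cont_subf; [exact: cG|exact: cont_cstf].
- move=> y Omy; apply: has_grad_sub; first apply: has_grad_sub.
  + by apply: has_grad_scale; exact: hP.
  + by apply: has_grad_scale; apply: has_grad_sub; [exact: hf|exact: has_grad_cst].
  + by apply: has_grad_sqr; apply: has_grad_sub; [exact: hG|exact: has_grad_cst].
have uz0 : 0 < u z by lra.
have fz := minf z Omz uz0.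
have Kf : 0 <= K * (f z - m) by rewrite mulr_ge0 ?subr_ge0// ltW.
have Gsq := sqr_ge0 (G z - g1).
move: Hz; rewrite fm !subrr mulr0 expr0n/= !subr0 => Hz.
case: crit => [uz|uz|].
- have : e * u z < e * u x1 by rewrite ltr_pM2l// uz /lo; lra.
  by lra.
- have Gg : `|G z - g1| <= h.
    rewrite -(@ler_pXn2r _ 2%N) ?nnegrE ?(ltW h0)// real_normK ?num_real// -/e.
    have : e * (u z - u x1) <= e * 1 by rewrite ler_pM2l// uz; lra.
    by lra.
  have zr : enorm (z - x0) < h * d by apply: ht1 => //; rewrite uz.
  have Pz : `|dot (P z) (z - x0)| <= h.
    have PzE : enorm (P z) * enorm (z - x0) <= h.
      apply: (@le_trans _ _ (d^-1 * (h * d))); last by rewrite mulrCA mulVf ?mulr1// gt_eqF.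
      by apply: ler_pM; rewrite ?enorm_ge0 ?P_le// ltW.
    have := dot_le_enorm (P z) (z - x0); have := dot_le_enorm (- P z) (z - x0).
    rewrite enormN dotNl => h1 h2; rewrite ler_norml; apply/andP; split; lra.
  have : `|g1 - -1| <= 3 * h.
    move: Gg Pz; rewrite /G !ler_norml => /andP[a1 a2] /andP[b1 b2].
    by apply/andP; split; lra.
  by rewrite /h; lra.
- rewrite !subr0 => crit0.
  have crit : e *: P z + (- K) *: DF z + (- (2 * (G z - g1))) *: DG z = 0.
    by rewrite (scaleNr K) (scaleNr (2 * _)).
  have E1 := dot_lin3 (P z) crit; have E2 := dot_lin3 (z - x0) crit.
  move: E1 E2; rewrite PDF// /DG dotBr (dot_egrad_grad_along oOm u2)//.
  rewrite -/(DG z) -!/(f z) -/P -/DF !(dotC (z - x0)).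
  have fE : dot (P z) (P z) = f z by [].
  rewrite fE => E1 E2.
  have /hB : A z.
    by split; [apply: subset_closure; case: Omz|rewrite /= in_itv/= z1].
  rewrite /Bf; move: E1 E2 fz; set X := dot (DF z) _; set g := G z - g1.
  set Y := dot (DG z) _; set W := dot (P z) _ => E1 E2 fz.
  have efK : g * (e * W - 2 * g * Y) = e * f z * K.
    have -> : e * W - 2 * g * Y = K * X by lra.
    have -> : e * f z = g * X by lra.
    by ring.
  rewrite efK ger0_norm; last first.
    by apply: mulr_ge0 (ltW K0); apply: mulr_ge0 (ltW e0) _; exact: le_trans (ltW m0) fz.
  rewrite leNgt => /negP; apply; rewrite (@lt_le_trans _ _ (e * m * K))//.
    by rewrite emK ltrDl.
  by rewrite ler_pM2r// ler_pM2l.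
Qed.

(** At points of minimal speed near the pole, [legendre] gives [1 - u z <= sqrt m |z - x0|] and the
    blow-up gives nearly [|z - x0| / d]. Hence [sqrt m >= d^-1], every point has minimal speed, and
    [legendre] applies to all of them. *)
Let speed_const x : Om x -> 0 < u x -> G x = -1.
Proof.
have [m m0 [minf levm]] := min_speed.
move=> Omx ux; apply: (@legendre m) => //.
apply/eqP; rewrite eq_le minf// andbT; apply: le_trans (f_le Omx) _.
have -> : m = Num.sqrt m ^+ 2 by rewrite sqr_sqrtr// ltW.
rewrite ler_pXn2r ?nnegrE ?sqrtr_ge0 ?invr_ge0 ?(ltW d0)//.
apply/ler_addgt0Pr => eps eps0.
have [r0 r00 hr] := potential_blowup n2 oO bO Ox0 hu bys ysmin eps0.
have [t t01 ht] := near_top r00; have [z [Omz uz fz]] := levm t t01.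
have z0 : 0 < enorm (z - x0) by apply: enorm_sub_gt0; case: Omz.
have uz0 : 0 < u z by rewrite uz; case/andP: t01.
have Gz := legendre m0 minf Omz uz0 fz.
have /hr : 0 < enorm (z - x0) < r0 by rewrite z0 ht// uz.
have : 1 - u z <= Num.sqrt m * enorm (z - x0).
  have := dot_le_enorm (- P z) (z - x0); rewrite enormN dotNl.
  have -> : enorm (P z) = Num.sqrt m by rewrite -fz enormE.
  by move: Gz; rewrite /G; lra.
move=> h1 h2; have := le_trans h2 h1; rewrite ler_pM2r//; rewrite -/d; lra.
Qed.

(** The identity [G = -1] says that [q] has zero radial derivative, and [q] tends to [d^-1] at the
    pole. A penalized maximum over an annulus replaces integration along the ray. *)
Let ball_cone x : 0 < enorm (x - x0) < d -> u x = 1 - d^-1 * enorm (x - x0).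
Proof.
move=> /andP[x0' xd]; pose q y := (1 - u y) * (enorm (y - x0))^-1.
have ball_Om y : 0 < enorm (y - x0) < d -> Om y /\ 0 < u y.
  move=> /andP[y0 yd]; have Oy := ball_sub yd; split; first split => //.
    by move=> E; move: y0; rewrite E subrr enorm0 ltxx.
  apply: lt_le_trans (u_cone Oy); rewrite subr_gt0 ltr_pdivrMl//.
  by rewrite mulr1.
have [Omx ux] : Om x /\ 0 < u x by apply: ball_Om; rewrite x0'.
suff qd : q x = d^-1.
  by rewrite -qd /q mulrAC mulfK ?gt_eqF//; lra.
set a := q x; apply/eqP; rewrite eq_le; apply/andP; split.
  by rewrite /a/q ler_pdivrMr//; have := u_cone (proj1 Omx); lra.
rewrite leNgt; apply/negP => ad.
(* On the inner sphere the blow-up gives [q >= d^-1 - h = a + h]. *)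
pose h := (d^-1 - a) / 2.
have h0 : 0 < h by rewrite divr_gt0// subr_gt0.
have [r0 r00 hr] := potential_blowup n2 oO bO Ox0 hu bys ysmin h0.
pose r1 := Num.min (r0 / 2) (enorm (x - x0) / 2).
have r10 : 0 < r1 by rewrite lt_min !divr_gt0.
have r1r : r1 < r0.
  by rewrite (@le_lt_trans _ _ (r0 / 2))// ?ge_min ?lexx//; lra.
have r1x : r1 < enorm (x - x0).
  by rewrite (@le_lt_trans _ _ (enorm (x - x0) / 2))// ?ge_min ?lexx ?orbT//; lra.
pose r2 := (enorm (x - x0) + d) / 2.
have r2x : enorm (x - x0) < r2 by rewrite /r2; lra.
have r2d : r2 < d by rewrite /r2; lra.
(* Small enough that the penalty [e |x - x0|] stays below [h ^+ 2], which excludes the inner sphere;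
   its sign excludes the outer one. *)
pose e := h ^+ 2 / (2 * d).
have e0 : 0 < e by rewrite divr_gt0 ?exprn_gt0// mulr_gt0.
have ed : e * d < h ^+ 2.
  by rewrite /e invfM mulrA mulfVK ?gt_eqF// ltr_pdivrMr// ltr_pMr ?exprn_gt0// ltr1n.
pose H y := - (q y - a) ^+ 2 - e * enorm (y - x0).
pose A := [set y : 'rV[R]_n | r1 <= enorm (y - x0) <= r2].
have AOm y : A y -> Om y /\ 0 < u y.
  by move=> /andP[y1 y2]; apply: ball_Om; lra.
have cq y : Om y -> {for y, continuous q}.
  move=> Omy; apply: cont_mulf; first by apply: cont_subf; [exact: cont_cstf|exact: cuO].
  by apply: cont_inv_enorm; case: Omy.
have [|||z [Az zmax]] := @compact_max _ _ A H.
- exact: compact_annulus.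
- by exists x; rewrite /A/= !ltW.
- move=> y /AOm[Omy _]; apply: cont_subf.
    by apply: cont_oppf; apply: cont_sqrf; apply: cont_subf; [exact: cq|exact: cont_cstf].
  by apply: cont_mulf; [exact: cont_cstf|exact: cont_enorm].
have Hx : - (e * enorm (x - x0)) <= H z.
  have /zmax : A x by rewrite /A/= !ltW.
  by rewrite /H subrr expr0n/= oppr0 sub0r.
have [Omz uz] := AOm z Az; have /andP[zr1 zr2] := Az.
have z0 : 0 < enorm (z - x0) by lra.
have sq0 := sqr_ge0 (q z - a).
have zr2' : enorm (z - x0) < r2.
  rewrite lt_neqAle zr2 andbT; apply/eqP => E.
  have : e * enorm (x - x0) < e * r2 by rewrite ltr_pM2l.
  by move: Hx; rewrite /H E; lra.
have zr1' : r1 < enorm (z - x0).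
  rewrite lt_neqAle zr1 andbT; apply/eqP => E.
  have /hr : 0 < enorm (z - x0) < r0 by rewrite -E r10.
  rewrite -/d -ler_pdivlMr// -/(q z) => hq.
  have : h ^+ 2 <= (q z - a) ^+ 2.
    rewrite ler_pXn2r ?nnegrE ?(ltW h0)//.
      by move: hq h0; rewrite /h; lra.
    by move: hq; rewrite /h; lra.
  have : e * enorm (x - x0) < e * d by rewrite ltr_pM2l.
  have : 0 <= e * enorm (z - x0) by rewrite mulr_ge0 ?ltW.
  by move: Hx; rewrite /H; lra.
have zx0 : z <> x0 by case: Omz.
pose r := enorm (z - x0).
pose Dq := r^-1 *: (0 - P z) + (1 - u z) *: (- (r ^- 3 *: (z - x0))).
have hq : has_grad q z Dq.
  apply: has_grad_mul; last exact: has_grad_inv_enorm.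
  by apply: has_grad_sub; [exact: has_grad_cst|exact: hP].
have Dqz : dot Dq (z - x0) = 0.
  rewrite /Dq sub0r dotDl !dotZl !dotNl dotZl -sqr_enorm -/r.
  have := speed_const Omz uz; rewrite /G => Gz.
  have -> : dot (P z) (z - x0) = u z - 1 by lra.
  by field; rewrite gt_eqF.
have gH : has_grad H z (- ((2 * (q z - a)) *: (Dq - 0)) - e *: (r^-1 *: (z - x0))).
  apply: has_grad_sub.
    by apply: has_grad_opp; apply: has_grad_sqr; apply: has_grad_sub => //; exact: has_grad_cst.
  by apply: has_grad_scale; exact: has_grad_enorm.
have nearA : \forall y \near z, H y <= H z.
  have oA : open ((fun v => enorm (v - x0)) @^-1` `]r1, r2[%classic).
    by apply: open_comp; [move=> ? _; exact: enormB_continuous|exact: itv_open].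
  have : \forall v \near z, r1 < enorm (v - x0) < r2.
    apply: open_nbhs_nbhs; split; first by move: oA; rewrite set_itvE.
    by rewrite /= zr1'.
  by apply: filterS => v /andP[v1 v2]; apply: zmax; rewrite /A/= !ltW.
have := has_grad_local_max nearA gH => /(congr1 (dot^~ (z - x0))) /=.
rewrite dot0l subr0 dotBl dotNl !dotZl Dqz mulr0 oppr0 sub0r -sqr_enorm -/r => /eqP.
have pos : 0 < e * (r^-1 * r ^+ 2).
  by apply: mulr_gt0 => //; apply: mulr_gt0; rewrite ?invr_gt0// exprn_gt0.
by rewrite oppr_eq0 gt_eqF.
Qed.

Lemma C2_potential_ball : O = eball x0 d.
Proof.
apply/seteqP; split => [x Ox|x]; last exact: ball_sub.
rewrite /eball/= ltNge; apply/negP => dx.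
pose r := enorm (x - x0); have r0 : 0 < r by exact: lt_le_trans d0 dx.
pose y := x0 + (d / r) *: (x - x0).
have dr : 0 <= d / r <= 1.
  by apply/andP; split; [rewrite divr_ge0// ltW|rewrite ler_pdivrMr// mul1r].
have Oy : O y.
  have -> : y = (1 - d / r) *: x0 + (d / r) *: x.
    by apply/rowP => j; rewrite !mxE; ring.
  exact: convO.
have yd : enorm (y - x0) = d.
  rewrite addrAC subrr add0r enormZ ger0_norm ?divr_ge0 ?ltW//.
  by rewrite -/r divfK// gt_eqF.
have Omy : Om y.
  by split => // E; move: yd; rewrite E subrr enorm0 => dE; have := d0; rewrite -dE ltxx.
have uy : u y = 0.
  apply/eqP; rewrite eq_le u_ge0// andbT; apply/ler_addgt0Pr => e e0; rewrite add0r.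
  (* The point [w] at distance [s * d] from [y] inside the ball has [u w = s], and the Lipschitz
     bound adds another [s], so [u y <= 2 s <= e]. *)
  pose s := Num.min (e / 2) (2^-1 : R).
  have s0 : 0 < s by rewrite lt_min divr_gt0//=; lra.
  have se : s <= e / 2 by rewrite ge_min lexx.
  have s1 : s <= 2^-1 by rewrite ge_min lexx orbT.
  pose w := x0 + (1 - s) *: (y - x0).
  have wE : enorm (w - x0) = (1 - s) * d.
    by rewrite addrAC subrr add0r enormZ ger0_norm ?yd//; lra.
  have wd : 0 < enorm (w - x0) < d.
    by rewrite wE mulr_gt0 ?gtr_pMl//; lra.
  have Ow : O w by apply: ball_sub; case/andP: wd.
  have := u_lip Ow Oy; rewrite (ball_cone wd) wE.
  have -> : y - w = s *: (y - x0) by apply/rowP => j; rewrite !mxE; ring.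
  rewrite enormZ yd gtr0_norm// mulrCA mulVf ?gt_eqF// mulrCA mulVf ?gt_eqF//; lra.
have : \forall v \near y, u y <= u v.
  have : \forall v \near y, O v by exact: open_nbhs_nbhs.
  by apply: filterS => v Ov; rewrite uy u_ge0.
move=> /has_grad_local_min/(_ (hP Omy)) Py; have := f_gt0 Omy.
by rewrite /f/speed -/P Py dot0l ltxx.
Qed.

End C2Rigidity.

Lemma C2_on_eq {R : realType} {n : nat} (U U' : set 'rV[R]_n) (f g : 'rV[R]_n -> R) :
  open U -> open U' -> U' `<=` U -> (forall y, U' y -> f y = g y) ->
  C2_on U f -> C2_on U' g.
Proof.
move=> oU oU' sub fg f2.
have near_fg x : U' x -> \forall y \near x, f y = g y.
  move=> U'x; have : \forall y \near x, U' y by exact: open_nbhs_nbhs.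
  by apply: filterS => y; exact: fg.
have [|||||//] := @C2_onI _ _ U' g (fun i => partial i f)
  (fun i j => partial j (partial i f)) oU'.
- move=> x U'x; apply: cont_near_eq (near_fg x U'x) _.
  by case: (C2_on_cont oU f2 (sub x U'x)).
- move=> i x U'x; apply: near_eq_is_derive (near_fg x U'x) _.
  by case: (C2_on_derive f2 (sub x U'x)).
- by move=> i x U'x; case: (C2_on_cont oU f2 (sub x U'x)).
- by move=> i j x U'x; case: (C2_on_derive f2 (sub x U'x)).
- by move=> i j x U'x; case: (C2_on_cont oU f2 (sub x U'x)).
Qed.

(** * The potential of a ball, and concave potentials *)

Section Equivalences.
Context {R : realType} {n : nat}.
Variables (O : set 'rV[R]_n) (x0 : 'rV[R]_n) (u : 'rV[R]_n -> R).
Hypotheses (oO : open O) (bO : bounded_set O) (Ox0 : O x0).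
Hypothesis hu : inf_harmonic_potential O x0 u.

(** All boundary points are at distance [r] from the pole, so one cone bounds [u] from both
    sides. *)
Lemma ball_potential (r : R) : 0 < r -> O = eball x0 r ->
  forall y, O y -> u y = 1 - r^-1 * enorm (y - x0).
Proof.
move=> r0 OE y Oy; have nx0 : ~ (O `\ x0) x0 by move=> [_]; apply.
have rN0 : - r^-1 != 0 by rewrite oppr_eq0 invr_eq0 gt_eqF.
have at_x0 : 1 + - r^-1 * enorm (x0 - x0) = 1 by rewrite subrr enorm0 mulr0 addr0.
have clr z : closure O z -> enorm (z - x0) <= r.
  by apply: closure_enorm_le => {}z; rewrite OE => /ltW.
rewrite -mulNr; apply/eqP; rewrite eq_le; apply/andP; split.
  apply: (@potential_le _ _ O x0) => //; last by rewrite at_x0.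
  move=> z [/clr zr _]; rewrite mulNr subr_ge0 ler_pdivrMl//.
  by rewrite mulr1.
apply: (@potential_ge _ _ O x0) => //; last by rewrite at_x0.
move=> z [_ nO]; rewrite mulNr subr_le0 ler_pdivlMl// mulr1 leNgt.
by apply/negP => zr; apply: nO; rewrite OE.
Qed.

Lemma ball_potential_C2 (r : R) : 0 < r -> O = eball x0 r -> C2_on (O `\ x0) u.
Proof.
(* With bending parameter 0 the bent cone is the cone itself. *)
move=> r0 OE; have [C2 _] := bent_cone_C2 x0 1 (- r^-1) 0.
apply: C2_on_eq C2; first exact: open_neq.
- exact: open_punctured.
- by move=> y [].
- move=> y [Oy _]; rewrite (ball_potential r0 OE)//.
  by rewrite /bent_cone mul0r subr0 mulNr.
Qed.

Lemma ball_potential_concave (r : R) : 0 < r -> O = eball x0 r -> concave_on O u.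
Proof.
move=> r0 OE x y t Ox Oy /andP[t0 t1]; have hb := ball_potential r0 OE.
pose w := (1 - t) *: x + t *: y.
have wle : enorm (w - x0) <= (1 - t) * enorm (x - x0) + t * enorm (y - x0).
  have -> : w - x0 = (1 - t) *: (x - x0) + t *: (y - x0).
    by apply/rowP => j; rewrite !mxE; ring.
  apply: le_trans (ler_enormD _ _) _; rewrite !enormZ !ger0_norm//.
  by rewrite subr_ge0.
have Ow : O w.
  move: Ox Oy; rewrite OE /eball/= => xr yr; apply: le_lt_trans wle _.
  pose M := Num.max (enorm (x - x0)) (enorm (y - x0)).
  have Mr : M < r by rewrite gt_max xr.
  have xM : enorm (x - x0) <= M by rewrite le_max lexx.
  have yM : enorm (y - x0) <= M by rewrite le_max lexx orbT.
  have : (1 - t) * enorm (x - x0) <= (1 - t) * M by rewrite ler_wpM2l// subr_ge0.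
  have : t * enorm (y - x0) <= t * M by rewrite ler_wpM2l.
  by lra.
rewrite -/w !hb//; have : r^-1 * enorm (w - x0) <=
    r^-1 * ((1 - t) * enorm (x - x0) + t * enorm (y - x0)).
  by rewrite ler_pM2l ?invr_gt0.
by lra.
Qed.

(** At [w], a fraction [s] of the way from the pole to [x], concavity gives
    [1 - u w <= s (1 - u x)]. The blow-up at [w] then yields [1 - u x >= |x - x0| / d], and [u >= 0]
    bounds the distance by [d]. *)
Lemma concave_potential_ball ys : (2 <= n)%N -> (closure O `\` O) ys ->
  (forall z, (closure O `\` O) z -> enorm (ys - x0) <= enorm (z - x0)) ->
  concave_on O u -> O = eball x0 (enorm (ys - x0)).
Proof.
move=> n2 bys ysmin cc; set d := enorm (ys - x0).
have d0 : 0 < d := inradius_gt0 Ox0 bys.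
have ux0 : u x0 = 1 by case: hu.
have le_d x : O x -> enorm (x - x0) <= d.
  move=> Ox; have [->|/eqP xx0] := eqVneq x x0; first by rewrite subrr enorm0 ltW.
  have l0 := enorm_sub_gt0 xx0; set l := enorm (x - x0) in l0 *.
  suff H : d^-1 * l <= 1 - u x.
    have u0 : 0 <= u x by apply: (@potential_ge0 _ _ O x0).
    have : d^-1 * l <= 1 by lra.
    by rewrite ler_pdivrMl// mulr1.
  apply/ler_addgt0Pr => e e0; have el : 0 < e / l by rewrite divr_gt0.
  have [r0 r00 hr] := potential_blowup n2 oO bO Ox0 hu bys ysmin el.
  pose s := Num.min 1 (r0 / (2 * l)).
  have s0 : 0 < s by rewrite lt_min ltr01 divr_gt0// mulr_gt0.
  have s1 : s <= 1 by rewrite ge_min lexx.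
  have sl : s * l < r0.
    have : s <= r0 / (2 * l) by rewrite ge_min lexx orbT.
    by rewrite ler_pdivlMr ?mulr_gt0//; lra.
  have s01 : 0 <= s <= 1 by rewrite (ltW s0).
  have := cc x0 x s Ox0 Ox s01; rewrite ux0.
  set w := (_ *: x0 + _).
  have wE : enorm (w - x0) = s * l.
    have -> : w - x0 = s *: (x - x0) by apply/rowP => j; rewrite !mxE; ring.
    by rewrite enormZ gtr0_norm.
  have /hr : 0 < enorm (w - x0) < r0 by rewrite wE mulr_gt0.
  rewrite wE -/d => h1 h2.
  have : s * ((d^-1 - e / l) * l) <= s * (1 - u x) by lra.
  rewrite ler_pM2l// mulrBl divfK ?gt_eqF//; lra.
apply/seteqP; split=> x; last first.
  by move=> xd; apply: (@inball_sub _ _ O x0 oO Ox0 ys ysmin).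
move=> Ox; rewrite /eball/= lt_neqAle le_d// andbT; apply/eqP => xd.
(* A point of [O] at distance exactly [d] could be pushed outwards within the open set [O], past
   that bound. *)
have /nbhs_eballP[r r0 hr] : nbhs x O by exact: open_nbhs_nbhs.
pose s := r / (2 * d).
have s0 : 0 < s by rewrite divr_gt0// mulr_gt0.
have sd : s * d = r / 2 by rewrite /s; field; rewrite gt_eqF.
have /hr/le_d : eball x r (x + s *: (x - x0)).
  by rewrite /eball/= addrAC subrr add0r enormZ xd gtr0_norm// sd; lra.
have -> : x + s *: (x - x0) - x0 = (1 + s) *: (x - x0).
  by apply/rowP => j; rewrite !mxE; ring.
rewrite enormZ xd gtr0_norm ?addr_gt0//; nra.
Qed.

End Equivalences.

Unset Implicit Arguments.

Theorem theorem1p4 (R : realType) (n : nat) (O : set 'rV[R]_n) (x0 : 'rV[R]_n)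
  (u : 'rV[R]_n -> R) :
  (2 <= n)%N ->
  bounded_convex_domain O -> O x0 ->
  inf_harmonic_potential O x0 u ->
  ((exists r : R, 0 < r /\ O = eball x0 r) <-> C2_on (O `\ x0) u) /\
  (C2_on (O `\ x0) u <-> concave_on O u).
Proof.
move=> n2 [oO _ bO convO] Ox0 hu.
have [ys bys ysmin] := nearest_boundary_point n2 oO bO Ox0.
have d0 := inradius_gt0 Ox0 bys.
have i_ii : (exists r : R, 0 < r /\ O = eball x0 r) -> C2_on (O `\ x0) u.
  by move=> [r [r0 OE]]; exact: ball_potential_C2 r0 OE.
have i_iii : (exists r : R, 0 < r /\ O = eball x0 r) -> concave_on O u.
  by move=> [r [r0 OE]]; exact: ball_potential_concave r0 OE.
have ii_i : C2_on (O `\ x0) u -> exists r : R, 0 < r /\ O = eball x0 r.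
  move=> u2; exists (enorm (ys - x0)); split => //.
  exact: (@C2_potential_ball _ _ O x0 ys u).
have iii_i : concave_on O u -> exists r : R, 0 < r /\ O = eball x0 r.
  by move=> cc; exists (enorm (ys - x0)); split => //; apply: (@concave_potential_ball _ _ O x0 u).
by split; split; auto.
Qed.
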